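(* Let $k$ be even (and positive). For $n\ge1$ let $\mathrm{Pf}_{k,n}$ be the polynomial on $\bigotimes^{2k}\mathbb{C}^{2kn}$ (in the $(2kn)^{2k}$ coordinate variables) defined by $\mathrm{Pf}_{k,n}(p)=\langle e_1\wedge\cdots\wedge e_{2kn},\,p^{\otimes n}\rangle$, where $p^{\otimes n}\in\bigotimes^n\bigotimes^{2k}\mathbb{C}^{2kn}\cong\bigotimes^{2kn}\mathbb{C}^{2kn}$. Then the family $\mathrm{Pf}_k=(\mathrm{Pf}_{k,1},\mathrm{Pf}_{k,2},\dots)$ is VNP-complete (under p-projections).
   Context: $e_1,\dots,e_N$ is the standard basis of $\mathbb{C}^N$; $e_1\wedge\cdots\wedge e_N=\frac{1}{N!}\sum_{\sigma\in\mathcal{S}_N}\mathrm{sgn}(\sigma)\,e_{\sigma(1)}\otimes\cdots\otimes e_{\sigma(N)}$, and $\langle\cdot,\cdot\rangle$ is the standard bilinear form on $\bigotimes^N\mathbb{C}^N$ in which tensor products of standard basis vectors are orthonormal. $\mathrm{Pf}_{k,n}$ is the hyperpfaffian (Barvinok); it is homogeneous of degree $n$, so $\mathrm{Pf}_k$ is a p-family. VNP-completeness is in Valiant's sense: the family lies in VNP and every family in VNP is a p-projection of it. *)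

(* Defs.v *)
From HB Require Import structures.
From mathcomp Require Import all_boot all_order all_algebra all_fingroup.
From mathcomp Require Import complex reals.
From mathcomp Require Import mpoly.

Set Implicit Arguments.
Unset Strict Implicit.
Unset Printing Implicit Defensive.

Import Order.TTheory GRing.Theory Num.Theory.
Local Open Scope ring_scope.

(** * Tensors in coordinates and the hyperpfaffian *)

(* A tensor in the m-fold tensor power of A^N is given by its N ^ m coordinates
   in the basis of tensor products of standard basis vectors.  The ring of
   coordinates A is arbitrary, so that one can take the field itself as well as
   a polynomial ring over it (for the generic tensor below). *)
Definition multi_index (m N : nat) := {ffun 'I_m -> 'I_N}.

Definition tensor (A : Type) (m N : nat) := {ffun multi_index m N -> A}.

Section Tensors.
Variable A : comUnitRingType.

Definition tensor_prod (m N : nat) (v : 'I_m -> 'rV[A]_N) : tensor A m N :=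
  [ffun J : multi_index m N => \prod_(i < m) v i 0 (J i)].

Definition std_basis (N : nat) (i : 'I_N) : 'rV[A]_N := delta_mx 0 i.

Definition wedge_std (N : nat) : tensor A N N :=
  [ffun J => (N`!)%:R^-1 *
     \sum_(s : 'S_N) (-1) ^+ s * tensor_prod (fun i => std_basis (s i)) J].

Definition tensor_form (m N : nat) (u v : tensor A m N) : A :=
  \sum_(J : multi_index m N) u J * v J.

Lemma block_pos_subproof (d n : nat) (i : 'I_n) (j : 'I_d) :
  (i * d + j < d * n)%N.
Proof.
rewrite (mulnC d); apply: (@leq_trans (i.+1 * d)%N).
  by rewrite mulSn addnC ltn_add2r.
by rewrite leq_mul2r ltn_ord orbT.
Qed.

(* The j-th tensor factor of the i-th copy sits at position i * d + j: this is
   the identification of the n-fold tensor power of the d-fold one with the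
   (d * n)-fold one. *)
Definition block_pos (d n : nat) (i : 'I_n) (j : 'I_d) : 'I_(d * n) :=
  Ordinal (block_pos_subproof i j).

Definition tensor_exp (d N : nat) (p : tensor A d N) (n : nat) :
    tensor A (d * n) N :=
  [ffun J : multi_index (d * n) N =>
     \prod_(i < n) p [ffun j : 'I_d => J (block_pos i j)]].

Definition hyperpfaffian (k n : nat) (p : tensor A (2 * k) (2 * k * n)) : A :=
  tensor_form (wedge_std (2 * k * n)) (tensor_exp p n).

End Tensors.

(* One variable per coordinate; their number is N ^ d, by card_ffun. *)
Definition generic_tensor (F : idomainType) (d N : nat) :
    tensor {mpoly F[#|multi_index d N|]} d N :=
  [ffun J => 'X_(enum_rank J)].

Definition hyperpf_poly (F : idomainType) (k n : nat) :
    {mpoly F[#|multi_index (2 * k) (2 * k * n)|]} :=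
  hyperpfaffian (generic_tensor F (2 * k) (2 * k * n)).

Lemma card_multi_index (d N : nat) : #|multi_index d N| = (N ^ d)%N.
Proof. by rewrite card_ffun !card_ord. Qed.

Lemma hyperpf_polyE (F : numFieldType) (k n : nat)
    (p : tensor F (2 * k) (2 * k * n)) :
  (hyperpf_poly F k n).@[fun i => p (enum_val i)] = hyperpfaffian p.
Proof.
rewrite /hyperpf_poly /hyperpfaffian /tensor_form rmorph_sum /=.
apply: eq_bigr => J _; rewrite rmorphM /= !ffunE; congr (_ * _); last first.
  rewrite rmorph_prod; apply: eq_bigr => i _.
  by rewrite ffunE /= mevalXU enum_rankK.
rewrite rmorphM rmorph_sum /= rmorphV /=; last first.
  rewrite -mpolyC_nat rmorph_unit // unitfE pnatr_eq0.
  by rewrite -lt0n fact_gt0.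
rewrite rmorph_nat; congr (_ * _); apply: eq_bigr => s _.
rewrite rmorphM /= rmorphXn /= rmorphN1 !ffunE; congr (_ * _).
rewrite rmorph_prod; apply: eq_bigr => i _.
by rewrite /std_basis !mxE rmorph_nat.
Qed.

(** * Valiant's classes *)

Definition p_bounded (t : nat -> nat) : Prop :=
  exists c : nat, forall n, (t n <= n ^ c + c)%N.

(* A family (f_1, f_2, ...) is stored with f_(n+1) at index n. *)
Record poly_family (F : fieldType) := PolyFamily {
  nvars : nat -> nat;
  family_poly :> forall n, {mpoly F[nvars n]}
}.

Section Valiant.
Variable F : fieldType.
Implicit Types f g : poly_family F.

(* msize is the total degree plus one (zero for the zero polynomial). *)
Definition p_family f : Prop :=
  p_bounded (nvars f) /\ p_bounded (fun n => (msize (f n)).-1).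

(* Arithmetic circuits, given by the list of their gates in topological order;
   the arguments of an arithmetic gate are the positions of earlier gates. *)
Inductive gate (v : nat) : Type :=
| GVar of 'I_v
| GConst of F
| GAdd of nat & nat
| GMul of nat & nat.

Definition circuit (v : nat) := seq (gate v).

Definition gate_wf v (pos : nat) (G : gate v) : bool :=
  match G with
  | GVar _ | GConst _ => true
  | GAdd i j | GMul i j => (i < pos)%N && (j < pos)%N
  end.

Fixpoint circuit_wf_from v (pos : nat) (c : circuit v) : bool :=
  if c is G :: c' then gate_wf pos G && circuit_wf_from pos.+1 c' else true.

Definition circuit_wf v (c : circuit v) : bool := circuit_wf_from 0 c.

Definition gate_poly v (vals : seq {mpoly F[v]}) (G : gate v) : {mpoly F[v]} :=
  match G with
  | GVar i => 'X_i
  | GConst a => a%:MP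
  | GAdd i j => vals`_i + vals`_j
  | GMul i j => vals`_i * vals`_j
  end.

Definition circuit_polys v (c : circuit v) : seq {mpoly F[v]} :=
  foldl (fun vals G => rcons vals (gate_poly vals G)) [::] c.

Definition circuit_computes v (c : circuit v) (P : {mpoly F[v]}) : Prop :=
  circuit_wf c /\ P \in circuit_polys c.

Definition in_VP f : Prop :=
  p_family f /\
  exists2 s : nat -> nat, p_bounded s &
    forall n, exists2 c : circuit (nvars f n),
      (size c <= s n)%N & circuit_computes c (f n).

(* Sum over all e in {0,1}^u of P(X_1, ..., X_v, e_1, ..., e_u). *)
Definition boolean_sum (v u : nat) (P : {mpoly F[v + u]}) : {mpoly F[v]} :=
  \sum_(e : {ffun 'I_u -> bool})
    (P \mPo [tuple match split i with
                   | inl j => 'X_j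
                   | inr j => (e j)%:R
                   end | i < v + u]).

Definition in_VNP f : Prop :=
  p_family f /\
  exists (u : nat -> nat) (g : forall n, {mpoly F[nvars f n + u n]}),
    in_VP (PolyFamily g) /\ forall n, f n = boolean_sum (g n).

Definition projection (v w : nat) (P : {mpoly F[v]}) (Q : {mpoly F[w]}) : Prop :=
  exists a : 'I_w -> F + 'I_v,
    P = Q \mPo [tuple match a i with
                      | inl c => c%:MP
                      | inr j => 'X_j
                      end | i < w].

Definition p_projection f g : Prop :=
  exists2 t : nat -> nat, p_bounded t & forall n, projection (f n) (g (t n)).

Definition VNP_complete g : Prop :=
  in_VNP g /\ forall f, in_VNP f -> p_projection f g.

End Valiant.

Definition hyperpf_family (F : fieldType) (k : nat) : poly_family F :=
  PolyFamily (fun n => hyperpf_poly F k n.+1).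

(* Main.v *)
Require Import Defs.
From mathcomp Require Import all_boot all_order all_algebra all_fingroup.
From mathcomp Require Import complex reals mpoly zify.

(**
The coefficient of a monomial in a product of affine forms is, up to a nonzero constant, a
permanent with repeated columns. Over an algebraically closed field every linear functional on
univariate polynomials of bounded degree has the form [p |-> coefficient of x^n in h p] with [h] a
product of affine forms, so the sum over [e] in {0,1}^U of a product of affine forms in [e] is a
projection of a permanent; so is such a sum subject to constraints [phi (sum_u a_u e_u)], since
[phi] interpolates to a polynomial that factors again. The permanent itself is a projection of the
hyperpfaffian: replace each vertex of a bipartite graph by [k] consecutive indices; as [k] is even,
all signs are [+1].

A circuit of polynomial size and degree is homogenised, its components of degree zero being
absorbed as constants. Unfolding the output from the top, a gate of degree [i] is used at most
[deg / i] times, so the polynomial is a sum over configurations that tell which summand each of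
the [deg] copies of a gate selects. The consistency of a configuration is a family of linear
constraints on its one-hot encoding.

Conversely the sign of a map [J] from {0, ..., N-1} to itself ([0] if [J] is not injective) is a
quotient of Vandermonde products, which makes the hyperpfaffian a Boolean sum of a small formula.
*)

Set Implicit Arguments.
Unset Strict Implicit.
Unset Printing Implicit Defensive.

Import Order.TTheory GRing.Theory Num.Theory.
Local Open Scope ring_scope.

(** * Polynomially bounded functions *)

Lemma leq_expW (c m n : nat) : (m <= n)%N -> (m ^ c <= n ^ c)%N.
Proof. by case: c => // c mn; rewrite leq_exp2r. Qed.

(** As the base [n.+2] is at least 2, additive constants are absorbed by a larger exponent, and
    exponents add under products. *)
Lemma p_boundedP (t : nat -> nat) :
  p_bounded t <-> exists c : nat, forall n, (t n <= n.+2 ^ c)%N.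
Proof.
split=> -[c tc].
  exists c.+1 => n; apply: leq_trans (tc n) _.
  have c_le : (c <= n.+2 ^ c)%N.
    by apply: leq_trans (ltnW (ltn_expl c (ltnSn 1))) _; apply: leq_expW.
  have n_le : (n ^ c <= n.+2 ^ c)%N by apply: leq_expW; lia.
  rewrite expnS; nia.
(* For [n] equal to 0 or 1 the additive constant suffices, since [n.+2 <= 3]; for larger [n] one has
   [n.+2 <= n ^ 2], so the exponent [2 * c] is enough. *)
exists (3 ^ c)%N => n; apply: leq_trans (tc n) _.
have c_le : (2 * c <= 3 ^ c)%N.
  by elim: c {tc} => // c; rewrite expnS; case: c => [|c] //; lia.
case: n => [|[|n]].
- by apply: leq_trans (leq_addl _ _); apply: leq_expW.
- by apply: leq_trans (leq_addl _ _); apply: leq_expW.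
apply: leq_trans (leq_addr _ _).
apply: (@leq_trans ((n.+2 ^ 2) ^ c)%N); first by apply: leq_expW; nia.
by rewrite -expnM leq_exp2l.
Qed.

Lemma p_bounded_le (t t' : nat -> nat) :
  (forall n, (t n <= t' n)%N) -> p_bounded t' -> p_bounded t.
Proof. by move=> tt' [c t'c]; exists c => n; apply: leq_trans (t'c n). Qed.

Lemma p_bounded_const (a : nat) : p_bounded (fun=> a).
Proof. by exists a => n; rewrite leq_addl. Qed.

Lemma p_bounded_id : p_bounded id.
Proof. by exists 1%N => n; rewrite expn1 leq_addr. Qed.

Lemma p_bounded_add (t t' : nat -> nat) :
  p_bounded t -> p_bounded t' -> p_bounded (fun n => t n + t' n)%N.
Proof.
move=> /p_boundedP[c tc] /p_boundedP[c' tc']; apply/p_boundedP.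
exists (c + c').+1 => n; have := tc n; have := tc' n.
rewrite expnS expnD.
have : (0 < n.+2 ^ c)%N by rewrite expn_gt0.
have : (0 < n.+2 ^ c')%N by rewrite expn_gt0.
by move: (n.+2 ^ c)%N (n.+2 ^ c')%N => x y; nia.
Qed.

Lemma p_bounded_mul (t t' : nat -> nat) :
  p_bounded t -> p_bounded t' -> p_bounded (fun n => t n * t' n)%N.
Proof.
move=> /p_boundedP[c tc] /p_boundedP[c' tc']; apply/p_boundedP.
by exists (c + c')%N => n; rewrite expnD leq_mul.
Qed.

Lemma p_bounded_exp (t : nat -> nat) (a : nat) :
  p_bounded t -> p_bounded (fun n => t n ^ a)%N.
Proof.
move=> /p_boundedP[c tc]; apply/p_boundedP.
by exists (c * a)%N => n; rewrite expnM; case: a => // a; rewrite leq_exp2r.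
Qed.

Lemma p_bounded_succ (t : nat -> nat) :
  p_bounded t -> p_bounded (fun n => (t n).+1).
Proof.
move=> t_bnd; apply: p_bounded_le (p_bounded_add t_bnd (p_bounded_const 1)) => n.
by rewrite addn1.
Qed.

(** * The hyperpfaffian as a signed sum *)

(** Its determinant extends the sign from permutations to all maps, with value 0 on the
    non-injective ones. *)
Definition selection_mx (A : comPzRingType) (N : nat) (J : multi_index N N) : 'M[A]_N :=
  \matrix_(i, j) (J i == j)%:R.

Lemma wedge_stdE (A : comUnitRingType) (N : nat) (J : multi_index N N) :
  wedge_std A N J = (N`!)%:R^-1 * \det (selection_mx A J).
Proof.
rewrite ffunE; congr (_ * _); apply: eq_bigr => s _; congr (_ * _).
by rewrite ffunE; apply: eq_bigr => i _; rewrite !mxE eqxx.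
Qed.

Lemma rmorph_det_selection (A B : comNzRingType) (f : {rmorphism A -> B}) (N : nat)
    (J : multi_index N N) :
  f (\det (selection_mx A J)) = \det (selection_mx B J).
Proof.
rewrite -det_map_mx; congr (\det _); apply/matrixP => i j.
by rewrite !mxE rmorph_nat.
Qed.

Lemma hyperpf_poly_comp (F : numFieldType) (k n w : nat)
    (t : #|multi_index (2 * k) (2 * k * n)|.-tuple {mpoly F[w]}) :
  hyperpf_poly F k n \mPo t =
  ((2 * k * n)`!)%:R^-1 *:
    \sum_(J : multi_index (2 * k * n) (2 * k * n))
      \det (selection_mx _ J) *
      \prod_(i < n) tnth t (enum_rank [ffun j => J (block_pos i j)]).
Proof.
rewrite /hyperpf_poly /hyperpfaffian /tensor_form rmorph_sum /= scaler_sumr.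
apply: eq_bigr => J _; rewrite rmorphM /= wedge_stdE rmorphM /=.
rewrite rmorph_det_selection scalerAl; congr (_ * _).
  rewrite -mul_mpolyC; congr (_ * _).
  rewrite -mpolyC_nat -rmorphV /= ?comp_mpolyC //.
  by rewrite unitfE pnatr_eq0 -lt0n fact_gt0.
rewrite ffunE rmorph_prod; apply: eq_bigr => i _.
by rewrite ffunE /= comp_mpolyXU -tnth_nth.
Qed.

Lemma det_selection_inj (A : comPzRingType) (N : nat) (J : multi_index N N) :
  injective J -> exists2 s : 'S_N, J =1 s & \det (selection_mx A J) = (-1) ^+ s.
Proof.
move=> J_inj; exists (perm J_inj); first by move=> x; rewrite permE.
rewrite -det_perm; congr (\det _); apply/matrixP => i j.
by rewrite !mxE permE.
Qed.

Lemma det_selection_ninj (A : comPzRingType) (N : nat) (J : multi_index N N) x y :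
  x != y -> J x = J y -> \det (selection_mx A J) = 0.
Proof.
by move=> xy Jxy; apply: (determinant_alternate xy) => j; rewrite !mxE Jxy.
Qed.

(** * Sign of a blown-up permutation *)

(* [s] is the product of its restriction to [P] and of the conjugate by [c] of this restriction. *)
Lemma even_perm_paired (T : finType) (s c : {perm T}) (P : pred T) :
    (forall x, P (c x) = ~~ P x) -> (forall x, c (c x) = x) ->
    (forall x, P (s x) = P x) -> (forall x, s (c x) = c (s x)) ->
  odd_perm s = false.
Proof.
move=> Pc cc Ps sc; pose H x := if P x then s x else x.
have H_inj : injective H.
  move=> x y; rewrite /H; case: ifP => Px; case: ifP => Py //.
  - exact: perm_inj.
  - by move=> sxy; move: Py; rewrite -sxy Ps Px.
  - by move=> sxy; move: Px; rewrite sxy Ps Py.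
suff -> : s = (perm H_inj * perm H_inj ^ c)%g by rewrite odd_permM odd_permJ addbb.
apply/permP => x; rewrite permM -[X in (_ ^ c)%g X]cc permJ !permE /H.
case Px: (P x); first by rewrite Pc Ps Px /= cc.
by rewrite Pc Px /= sc cc.
Qed.

(** * From the hyperpfaffian to the permanent *)

Section BlowUp.
Variables (k n : nat).

(** A pair stands for an edge of a bipartite graph on [n + n] vertices. The left vertex [x] becomes
    the [k] indices from [k * x] on, the right vertex [y] the [k] indices from [k * (n + y)] on. *)
Lemma blow_idx_lt (xy : 'I_n * 'I_n) (j : 'I_(2 * k)) :
  ((if j < k then k * xy.1 + j else k * (n + xy.2) + (j - k)) < 2 * k * n)%N.
Proof.
case: xy j => -[x xn] [y yn] [j jk] /=.
have : (k * x.+1 <= k * n)%N by rewrite leq_mul2l xn orbT.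
have : (k * y.+1 <= k * n)%N by rewrite leq_mul2l yn orbT.
by case: ifP; rewrite !mulnS ?mulnDr -mulnA; lia.
Qed.

Definition blow_pat (xy : 'I_n * 'I_n) : multi_index (2 * k) (2 * k * n) :=
  [ffun j => Ordinal (blow_idx_lt xy j)].

Hypothesis k_gt0 : (0 < k)%N.

Lemma unblock1_lt (z : 'I_(2 * k * n)) : (z %/ (2 * k) < n)%N.
Proof. by case: z => z /=; rewrite mulnC -ltn_divLR ?muln_gt0. Qed.

Lemma unblock2_lt (z : 'I_(2 * k * n)) : (z %% (2 * k) < 2 * k)%N.
Proof. by rewrite ltn_mod muln_gt0. Qed.

Lemma block_posK (z : 'I_(2 * k * n)) :
  block_pos (Ordinal (unblock1_lt z)) (Ordinal (unblock2_lt z)) = z.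
Proof. by apply: val_inj => /=; rewrite -divn_eq. Qed.

Lemma block_pos_ex (z : 'I_(2 * k * n)) : exists i j, z = block_pos i j.
Proof.
by exists (Ordinal (unblock1_lt z)), (Ordinal (unblock2_lt z)); rewrite block_posK.
Qed.

Lemma block_pos_inj (i i' : 'I_n) (j j' : 'I_(2 * k)) :
  block_pos i j = block_pos i' j' -> i = i' /\ j = j'.
Proof.
move=> /(congr1 val) /= e.
have k2 : (0 < 2 * k)%N by rewrite muln_gt0.
split; apply: val_inj => /=.
  have := congr1 (fun x => x %/ (2 * k))%N e.
  by rewrite !divnMDl // !divn_small // !addn0.
have := congr1 (fun x => x %% (2 * k))%N e.
by rewrite !modnMDl !modn_small.
Qed.

(** Block [i] follows the pattern of the edge [ab i]. Only such maps survive once the coordinates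
    off the patterns are set to 0. *)
Definition blow_up (ab : {ffun 'I_n -> 'I_n * 'I_n}) :
    multi_index (2 * k * n) (2 * k * n) :=
  [ffun z => blow_pat (ab (Ordinal (unblock1_lt z))) (Ordinal (unblock2_lt z))].

Lemma blow_up_block ab i j : blow_up ab (block_pos i j) = blow_pat (ab i) j.
Proof.
by rewrite ffunE; have [-> ->] := block_pos_inj (block_posK (block_pos i j)).
Qed.

(** The entries at positions 0 and [k] are [k * x] and [k * (n + y)], which determine the edge. *)
Lemma blow_pat_inj : injective blow_pat.
Proof.
move=> [x y] [x' y'] /ffunP e.
have j0_lt : (0 < 2 * k)%N by rewrite muln_gt0.
have jk_lt : (k < 2 * k)%N by rewrite -[X in (X < _)%N]mul1n ltn_mul2r k_gt0.
have := e (Ordinal j0_lt); have := e (Ordinal jk_lt).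
rewrite !ffunE => /(congr1 val) /= ey /(congr1 val) /= ex.
move: ex ey; rewrite k_gt0 ltnn !addn0 subnn !addn0 => /eqP.
rewrite eqn_mul2l eqn0Ngt k_gt0 /= => /eqP/val_inj -> /eqP.
by rewrite eqn_mul2l eqn0Ngt k_gt0 /= eqn_add2l => /eqP/val_inj ->.
Qed.

(** The [n] edges form a perfect matching. *)
Definition blow_inj (ab : {ffun 'I_n -> 'I_n * 'I_n}) :=
  injectiveb (fun i => (ab i).1) && injectiveb (fun i => (ab i).2).

(** Division of a value by [k] gives the vertex as quotient and the offset as remainder; in a
    matching the vertex determines the block. *)
Lemma blow_up_inj ab : blow_inj ab -> injective (blow_up ab).
Proof.
case/andP => /injectiveP a_inj /injectiveP b_inj z z'.
have [i [j ->]] := block_pos_ex z; have [i' [j' ->]] := block_pos_ex z'.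
rewrite !blow_up_block !ffunE => /(congr1 val) /=.
have div_k q r : (r < k)%N -> ((k * q + r) %/ k = q)%N.
  by move=> rk; rewrite mulnC divnMDl // divn_small // addn0.
have mod_k q r : (r < k)%N -> ((k * q + r) %% k = r)%N.
  by move=> rk; rewrite mulnC modnMDl modn_small.
have sub_k (l : 'I_(2 * k)) : (l < k)%N = false -> (l - k < k)%N.
  by case: l => l /=; lia.
have x_lt (l : 'I_n) := ltn_ord l.
case: ifP => jk; case: ifP => jk' e;
  have /= := congr1 (fun x => x %/ k)%N e; have /= := congr1 (fun x => x %% k)%N e;
  rewrite !(div_k, mod_k) ?sub_k // => er eq.
- have -> : i = i' by apply: a_inj; apply: val_inj.
  by congr block_pos; apply: val_inj.
- by have := x_lt (ab i).1; rewrite eq ltnNge leq_addr.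
- by have := x_lt (ab i').1; rewrite -eq ltnNge leq_addr.
have -> : i = i'.
  by apply: b_inj; apply: val_inj; apply/eqP; rewrite -(eqn_add2l n) eq.
congr block_pos; apply: val_inj => /=; move: jk jk' er.
by case: j j' {e} => j /= _ [j' /= _]; lia.
Qed.

Hypothesis k_even : ~~ odd k.

Lemma flip_lt (z : 'I_(2 * k * n)) :
  ((if odd z then z.-1 else z.+1) < 2 * k * n)%N.
Proof.
have : ~~ odd (2 * k * n) by rewrite !oddM.
by case: z => z /=; case: ifP; lia.
Qed.

(** Exchanges [2i] and [2i + 1]. As [k] is even, the indices of each vertex are a union of such
    pairs, so blown-up maps commute with this involution. *)
Definition flip z := Ordinal (flip_lt z).

Lemma flipK : involutive flip.
Proof.
by move=> z; apply: val_inj => /=; case: z => z /= _; case: ifP => /=; case: ifP; lia.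
Qed.

Lemma blow_pat_odd xy (j : 'I_(2 * k)) : odd (blow_pat xy j) = odd j.
Proof.
rewrite ffunE /=; case: ifP => jk; rewrite oddD oddM (negPf k_even) //=.
by rewrite oddB ?(negPf k_even) ?addbF // leqNgt jk.
Qed.

(** Since [j] and [k] are even, [j] and its successor lie on the same side of [k], hence belong to
    the same vertex. *)
Lemma blow_pat_succ xy (j j' : 'I_(2 * k)) :
  ~~ odd j -> j' = j.+1 :> nat -> blow_pat xy j' = (blow_pat xy j).+1 :> nat.
Proof.
move=> ev e; rewrite !ffunE /= e.
have -> : (j.+1 < k)%N = (j < k)%N.
  move: k_even ev; case: (j : nat) => [|l]; move: k_gt0; case: (k) => [|k'] //; lia.
by case: ifP => jk; rewrite ?addnS // subSn ?addnS // leqNgt jk.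
Qed.

Lemma blow_up_odd ab z : odd (blow_up ab z) = odd z.
Proof.
have [i [j ->]] := block_pos_ex z.
by rewrite blow_up_block blow_pat_odd /= oddD mulnCA oddM.
Qed.

Lemma blow_up_succ ab (z z' : 'I_(2 * k * n)) :
  ~~ odd z -> z' = z.+1 :> nat -> blow_up ab z' = (blow_up ab z).+1 :> nat.
Proof.
have [i [j ->]] := block_pos_ex z => ev e.
have j_ev : ~~ odd j by move: ev; rewrite /= oddD mulnCA oddM.
have j'_lt : (j.+1 < 2 * k)%N by case: (j) j_ev => l /=; lia.
have -> : z' = block_pos i (Ordinal j'_lt).
  by apply: val_inj; rewrite /= e addnS.
by rewrite !blow_up_block; apply: blow_pat_succ.
Qed.

Lemma blow_up_flip ab z : blow_up ab (flip z) = flip (blow_up ab z).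
Proof.
apply: val_inj => /=; rewrite blow_up_odd; case: ifP => z_odd.
  have -> // : blow_up ab z = (blow_up ab (flip z)).+1 :> nat.
  by apply: blow_up_succ; rewrite /= z_odd; case: (z : nat) z_odd => //= l; lia.
by apply: blow_up_succ; rewrite /= z_odd.
Qed.

(** The permutation of a matching preserves parity and commutes with [flip], so its actions on even
    and odd indices are conjugate and it is even. Without a matching two blocks agree at position 0
    or at position [k]. *)
Lemma det_blow_up (A : comPzRingType) ab :
  \det (selection_mx A (blow_up ab)) = (blow_inj ab)%:R.
Proof.
have j0_lt : (0 < 2 * k)%N by rewrite muln_gt0.
have jk_lt : (k < 2 * k)%N by rewrite -[X in (X < _)%N]mul1n ltn_mul2r k_gt0.
case ab_inj: (blow_inj ab); last first.
  move/negbT: ab_inj; rewrite negb_and => /orP[] /injectivePn[i [i' ii' e]].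
    apply: (@det_selection_ninj _ _ _ (block_pos i (Ordinal j0_lt))
                                    (block_pos i' (Ordinal j0_lt))).
      by apply: contraNneq ii' => /block_pos_inj[->].
    by apply: val_inj; rewrite !blow_up_block !ffunE /= k_gt0 e.
  apply: (@det_selection_ninj _ _ _ (block_pos i (Ordinal jk_lt))
                                  (block_pos i' (Ordinal jk_lt))).
    by apply: contraNneq ii' => /block_pos_inj[->].
  by apply: val_inj; rewrite !blow_up_block !ffunE /= ltnn e.
have [s Js ->] := det_selection_inj A (blow_up_inj ab_inj).
have -> // : odd_perm s = false.
pose c := perm (inv_inj flipK).
apply: (@even_perm_paired _ s c (fun z => odd z)) => z.
- by rewrite permE /=; case: (z : nat) => //= l; case l_odd: (odd l); rewrite /= ?l_odd.
- by rewrite !permE flipK.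
- by rewrite -Js blow_up_odd.
by rewrite -!Js !permE blow_up_flip.
Qed.

(** A matching listed edge by edge is a permutation together with one of the [n!] orderings of its
    edges. *)
Lemma sum_blow_inj (A : comPzRingType) (M : 'I_n -> 'I_n -> A) :
  \sum_(ab | blow_inj ab) \prod_(i < n) M (ab i).1 (ab i).2 =
  (n`!)%:R * \sum_(s : 'S_n) \prod_(i < n) M i (s i).
Proof.
pose to_perm (f : 'I_n -> 'I_n) : 'S_n := insubd (1%g : 'S_n) [ffun i => f i].
have to_permE f : injectiveb f -> to_perm f =1 f.
  move=> f_inj i; have f_inj' : injectiveb [ffun i => f i].
    by apply/injectiveP => x y; rewrite !ffunE; apply/injectiveP: x y.
  transitivity (val (to_perm f) i); first by rewrite -pvalE.
  by rewrite /to_perm insubdK // ffunE.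
pose h (p : 'S_n * 'S_n) : {ffun 'I_n -> 'I_n * 'I_n} :=
  [ffun i => (p.1 i, p.2 (p.1 i))].
pose h' (ab : {ffun 'I_n -> 'I_n * 'I_n}) :=
  (to_perm (fun i => (ab i).1), (to_perm (fun i => (ab i).1))^-1 *
                                to_perm (fun i => (ab i).2))%g.
rewrite (reindex_onto h h') /=; last first.
  move=> ab /andP[a_inj b_inj]; apply/ffunP => i.
  rewrite ffunE /= permM permK !to_permE //.
  by case: (ab i).
have h_inj p : blow_inj (h p).
  apply/andP; split; apply/injectiveP => i j; rewrite !ffunE /=.
    exact: perm_inj.
  by move=> /perm_inj/perm_inj.
have hK p : h' (h p) = p.
  have /andP[a_inj b_inj] := h_inj p.
  have e1 : to_perm (fun i => (h p i).1) = p.1.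
    by apply/permP => i; rewrite to_permE // ffunE.
  rewrite /h' e1; case: p {h_inj} a_inj b_inj e1 => p1 p2 /= a_inj b_inj e1.
  congr (_, _); apply/permP => i; rewrite permM to_permE // ffunE /=.
  by rewrite permKV.
under eq_bigl => p do rewrite h_inj hK eqxx.
rewrite -(pair_bigA _ (fun s1 s2 : 'S_n => \prod_i M (h (s1, s2) i).1 (h (s1, s2) i).2)) /=.
under eq_bigr => s1 _.
  rewrite (_ : \sum_(_ | _) _ = \sum_(s : 'S_n) \prod_(i < n) M i (s i)).
    over.
  apply: eq_bigr => s2 _; rewrite [RHS](reindex_inj (@perm_inj _ s1)) /=.
  by apply: eq_bigr => i _; rewrite ffunE.
by rewrite sumr_const card_Sn mulr_natl.
Qed.

End BlowUp.

Section Literals.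
Variables (F : fieldType) (v : nat).

Definition literal := (F + 'I_v)%type.

Definition lit_poly (l : literal) : {mpoly F[v]} :=
  match l with inl c => c%:MP | inr j => 'X_j end.

End Literals.

(** The coordinate indexed by the pattern of an edge [(x, y)] is replaced by [M x y], every other
    coordinate by 0. *)
Lemma permanent_projection (F : numFieldType) (v k n : nat)
    (M : 'I_n -> 'I_n -> literal F v) : (0 < k)%N -> ~~ odd k ->
  projection
    (((n`!)%:R / ((2 * k * n)`!)%:R) *:
       \sum_(s : 'S_n) \prod_(i < n) lit_poly (M i (s i)))
    (hyperpf_poly F k n).
Proof.
move=> k_gt0 k_even.
pose a (i : 'I_#|multi_index (2 * k) (2 * k * n)|) : literal F v :=
  if [pick xy | enum_val i == blow_pat k xy] is Some xy
  then M xy.1 xy.2 else inl 0.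
exists a; rewrite hyperpf_poly_comp mulrC -scalerA; congr (_ *: _).
have aE I : lit_poly (a (enum_rank I)) =
    \sum_xy (I == blow_pat k xy)%:R * lit_poly (M xy.1 xy.2).
  rewrite /a enum_rankK; case: pickP => [xy /eqP-> | no_xy].
    rewrite (bigD1 xy) //= eqxx mul1r big1 ?addr0 // => xy' ne.
    by rewrite (inj_eq (blow_pat_inj k_gt0)) eq_sym (negPf ne) mul0r.
  by rewrite /= big1 ?mpolyC0 // => xy _; rewrite no_xy mul0r.
transitivity (\sum_(ab : {ffun 'I_n -> 'I_n * 'I_n})
    \det (selection_mx {mpoly F[v]} (blow_up k_gt0 ab)) *
    \prod_(i < n) lit_poly (M (ab i).1 (ab i).2)).
  under [RHS]eq_bigr => ab _ do rewrite det_blow_up // mulr_natl mulrb.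
  rewrite -big_mkcond (sum_blow_inj (fun i j => lit_poly (M i j))).
  by rewrite -mpolyC_nat mul_mpolyC.
apply: esym.
under eq_bigr => J _.
  under eq_bigr => i _ do rewrite tnth_mktuple -/(lit_poly _) aE.
  rewrite (bigA_distr_bigA (fun i xy =>
    ([ffun j => J (block_pos i j)] == blow_pat k xy)%:R * lit_poly (M xy.1 xy.2))).
  rewrite mulr_sumr.
  over.
rewrite exchange_big; apply: eq_bigr => ab _ /=.
(* A map whose blocks follow the patterns of the edges [ab] is [blow_up ab]; any other map has a
   vanishing factor. *)
rewrite (bigD1 (blow_up k_gt0 ab)) //= [X in _ + X]big1 ?addr0 => [|J ne].
  congr (_ * _); apply: eq_bigr => i _.
  rewrite (_ : [ffun _ => _] = blow_pat k (ab i)) ?eqxx ?mul1r //.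
  by apply/ffunP => j; rewrite ffunE blow_up_block.
have [/forallP all_i | /forallPn[i ne_i]] :=
    boolP [forall i, [ffun j => J (block_pos i j)] == blow_pat k (ab i)].
  case/eqP: ne; apply/ffunP => z; have [i [j ->]] := block_pos_ex k_gt0 z.
  by rewrite blow_up_block -(eqP (all_i i)) ffunE.
by rewrite (bigD1 i) //= (negPf ne_i) !mul0r mulr0.
Qed.

Lemma big_option (R : Type) (idx : R) (op : Monoid.com_law idx) (T : finType)
    (F : option T -> R) :
  \big[op/idx]_o F o = op (F None) (\big[op/idx]_t F (Some t)).
Proof.
rewrite (bigD1 None) //=; congr (op _ _).
rewrite (reindex_omap Some id) /=; last by case.
by apply: eq_bigl => t; rewrite eqxx.
Qed.

(** * Permanents with repeated columns *)

(** The r-th element of a fibre of [f] is sent to the r-th element of the corresponding fibre of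
    [c]. *)
Lemma perm_of_same_fibers (I J : finType) (f c : I -> J) :
    (forall j, #|[pred i | f i == j]| = #|[pred i | c i == j]|) ->
  exists s : {perm I}, forall i, c (s i) = f i.
Proof.
move=> fc; pose E (g : I -> J) j := enum [pred i | g i == j].
have mE g i : i \in E g (g i) by rewrite mem_enum inE /=.
pose s i := nth i (E c (f i)) (index i (E f (f i))).
have idx i : (index i (E f (f i)) < size (E c (f i)))%N.
  by rewrite -cardE -fc cardE index_mem mE.
have cs i : c (s i) = f i.
  have : s i \in E c (f i) by rewrite mem_nth.
  by rewrite mem_enum inE => /eqP.
have s_inj : injective s.
  move=> i i' e; have ff' : f i = f i' by rewrite -!cs e.
  move: e; rewrite /s (set_nth_default i) // => /eqP.
  rewrite -ff' nth_uniq ?enum_uniq // => [|]; last by rewrite ff'.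
  by move/eqP; apply: (index_inj i); rewrite ?mE // ff' mE.
by exists (perm s_inj) => i; rewrite permE.
Qed.

(** The permutations [s] with a given composite of [c] after [s] form a coset of the stabiliser of
    [c], and the composites are exactly the functions with the fibre sizes of [c]. *)
Lemma sum_perm_lump (A : comPzRingType) (I J : finType) (c : I -> J)
    (a : I -> J -> A) :
  \sum_(s : {perm I}) \prod_i a i (c (s i)) =
  #|[set s : {perm I} | [forall i, c (s i) == c i]]|%:R *
  \sum_(f : {ffun I -> J} |
        [forall j, #|[pred i | f i == j]| == #|[pred i | c i == j]|])
    \prod_i a i (f i).
Proof.
rewrite (partition_big (fun s : {perm I} => [ffun i => c (s i)])
  (fun f : {ffun I -> J} =>
     [forall j, #|[pred i | f i == j]| == #|[pred i | c i == j]|])) /=; last first.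
  move=> s _; apply/forallP => j; apply/eqP.
  rewrite -!sum1_card [RHS](reindex_inj (@perm_inj _ s)).
  by apply: eq_bigl => i; rewrite !inE ffunE.
rewrite mulr_sumr; apply: eq_bigr => f /forallP same.
have [s0 cs0] := @perm_of_same_fibers _ _ f c (fun j => eqP (same j)).
pose stab := [set s : {perm I} | [forall i, c (s i) == c i]].
have cs_mem (s : {perm I}) : ([ffun i => c (s i)] == f) = (s \in mulg s0 @: stab).
  apply/eqP/imsetP => [/ffunP e | [t]].
    exists (s0^-1 * s)%g; last by rewrite mulKVg.
    rewrite inE; apply/forallP => i; rewrite permM.
    by have := e (s0^-1 i)%g; rewrite ffunE => ->; rewrite -cs0 permKV.
  by rewrite inE => /forallP ct ->; apply/ffunP => i; rewrite ffunE permM (eqP (ct _)) cs0.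
rewrite (eq_bigl _ _ cs_mem) (eq_bigr (fun=> \prod_i a i (f i))) => [|s].
  by rewrite sumr_const (card_imset _ (mulgI s0)) mulr_natl.
by rewrite -cs_mem => /eqP<-; apply: eq_bigr => i _; rewrite ffunE.
Qed.

(** * Boolean sums of products of affine forms *)

Section BooleanSums.
Variables (A : comNzRingType) (U W : finType).

(** The label [None] stands for the constant term, so that an affine form has one coefficient per
    label. *)
Let mon (o : option U) : 'X_{1.. #|U|} :=
  if o is Some u then U_(enum_rank u)%MM else 0%MM.

Lemma mon_sumE (I : finType) (f : I -> option U) u :
  (\sum_i mon (f i))%MM (enum_rank u) = #|[pred i | f i == Some u]|.
Proof.
rewrite mnm_sumE -[RHS]sum1_card [RHS]big_mkcond; apply: eq_bigr => i _.
rewrite inE /mon; case: (f i) => [u'|]; last by rewrite mnm0E.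
by rewrite mnm1E (inj_eq enum_rank_inj) (inj_eq Some_inj); case: eqP.
Qed.

(** The exponents are the sizes of the fibres over [Some u]; the size of the fibre over [None]
    follows because all of them add up to [#|I|]. *)
Lemma same_fibers_mon (I : finType) (f c : I -> option U) :
  [forall j, #|[pred i | f i == j]| == #|[pred i | c i == j]|] =
  ((\sum_i mon (f i))%MM == (\sum_i mon (c i))%MM).
Proof.
apply/forallP/eqP => [same | same].
  by apply/mnmP => i; rewrite -(enum_valK i) !mon_sumE (eqP (same _)).
have some_eq u : #|[pred i | f i == Some u]| = #|[pred i | c i == Some u]|.
  by rewrite -!mon_sumE same.
case=> [u|]; first by apply/eqP.
have total (g : I -> option U) : (\sum_j #|[pred i | g i == j]| = #|I|)%N.
  under eq_bigr => j _ do rewrite -sum1_card.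
  rewrite -sum1_card (exchange_big_dep predT) //=; apply: eq_bigr => i _.
  by rewrite (big_pred1 (g i)) // => j; rewrite inE eq_sym.
have := total f; rewrite -(total c) (bigD1 None) //= [X in _ = X -> _](bigD1 None) //=.
by rewrite (eq_bigr (fun j => #|[pred i | c i == j]|)) => [/addIn->|[u|] // _].
Qed.

Lemma prod_affine (I : finType) (a : I -> option U -> A) :
  \prod_i \sum_o a i o *: 'X_[mon o] =
  \sum_(f : {ffun I -> option U})
    (\prod_i a i (f i)) *: 'X_[\sum_i mon (f i)].
Proof.
rewrite bigA_distr_bigA; apply: eq_bigr => f _.
by rewrite scaler_prod mprodXE.
Qed.

(** On the left is a permanent whose columns are repeated according to [c]; on the right, the
    functions that yield the monomial are those with the fibre sizes of [c]. *)
Lemma sum_perm_coef (I : finType) (c : I -> option U) (a : I -> option U -> A) :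
  \sum_(s : {perm I}) \prod_i a i (c (s i)) =
  #|[set s : {perm I} | [forall i, c (s i) == c i]]|%:R *
  (\prod_i \sum_o a i o *: 'X_[mon o])@_(\sum_i mon (c i)).
Proof.
rewrite (sum_perm_lump c a) prod_affine raddf_sum /= big_mkcond; congr (_ * _).
apply: eq_bigr => f _; rewrite same_fibers_mon mcoeffZ mcoeffX.
by case: eqP => _; rewrite ?mulr1 ?mulr0.
Qed.

Let n := #|W|.
Variables (alpha beta : 'I_n -> A).
Hypothesis factorE : \prod_t (alpha t *: 'X + (beta t)%:P) =
  \poly_(p < n.+1) (if p == n then 2 else 1) :> {poly A}.

(** The functional [q |-> q(0) + q(1)] on powers of [x]. The polynomial in [factorE] has [lam p] as
    coefficient of [x^(n - p)], so multiplying by it and reading off the coefficient of [x^n]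
    realises this functional. *)
Let lam (p : nat) : A := \sum_(b : bool) b%:R ^+ p.

Lemma lamE p : lam p = if p == 0 then 2 else 1.
Proof.
rewrite /lam big_bool /= expr1n; case: p => [|p] /=; first by rewrite expr0.
by rewrite expr0n /= addr0.
Qed.

Lemma prod_factor u :
  \prod_t (alpha t *: 'X_[mon (Some u)] + (beta t) *: 'X_[mon None]) =
  \sum_(p < n.+1) lam p *: ('X_(enum_rank u) ^+ (n - p)) :> {mpoly A[#|U|]}.
Proof.
have := congr1 (fun p => (map_poly (@mpolyC #|U| A) p).['X_(enum_rank u)]) factorE.
rewrite rmorph_prod horner_prod /= => e; transitivity (\prod_t
  (map_poly (@mpolyC #|U| A) (alpha t *: 'X + (beta t)%:P)).['X_(enum_rank u)]).
  apply: eq_bigr => t _; rewrite rmorphD /= linearZ /= map_polyX map_polyC /=.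
  by rewrite hornerD hornerZ hornerX hornerC mul_mpolyC mpolyX0 alg_mpolyC.
rewrite e poly_def rmorph_sum horner_sum (reindex_inj rev_ord_inj) /=.
apply: eq_bigr => p _; rewrite subSS linearZ /= map_polyXn hornerZ hornerXn mul_mpolyC.
rewrite lamE; congr (_ *: _).
have := ltn_ord p; rewrite ltnS => pn.
by have -> : ((n - p)%N == n) = (p == 0%N :> nat) by apply/eqP/eqP; lia.
Qed.

(** In a term of the expanded product over [W] the variable of [u] occurs some [d u <= n] times.
    Extracting its n-th power gives [lam (d u)], which is the sum over the bit [e u] of its power of
    exponent [d u]. *)
Lemma boolean_sum_coef (a : W -> option U -> A) :
  ((\prod_w \sum_o a w o *: 'X_[mon o]) *
   \prod_u \prod_t (alpha t *: 'X_[mon (Some u)] + (beta t) *: 'X_[mon None]))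
    @_[multinom n | i < #|U|] =
  \sum_(e : {ffun U -> bool}) \prod_w (a w None + \sum_u (e u)%:R * a w (Some u)).
Proof.
under [X in _ * X]eq_bigr => u _ do rewrite prod_factor.
rewrite (prod_affine a) bigA_distr_bigA mulr_suml raddf_sum /=.
pose eo (e : {ffun U -> bool}) o : A := if o is Some u then (e u)%:R else 1.
have -> : \sum_(e : {ffun U -> bool})
    \prod_w (a w None + \sum_u (e u)%:R * a w (Some u)) =
  \sum_(e : {ffun U -> bool}) \sum_(f : {ffun W -> option U})
    \prod_w (eo e (f w) * a w (f w)).
  apply: eq_bigr => e _; rewrite -(bigA_distr_bigA (fun w o => eo e o * a w o)).
  by apply: eq_bigr => w _; rewrite big_option /= mul1r.
rewrite exchange_big /=; apply: eq_bigr => f _.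
rewrite -scalerAl mcoeffZ.
under [RHS]eq_bigr => e _ do rewrite big_split /= mulrC.
rewrite -[RHS]mulr_sumr; congr (_ * _).
pose d u := #|[pred w | f w == Some u]|.
have dn u : (d u < n.+1)%N by rewrite ltnS max_card.
transitivity (\prod_u lam (d u)); last first.
  rewrite /lam bigA_distr_bigA; apply: eq_bigr => e _.
  rewrite (partition_big f predT) //= big_option /= [X in _ = X * _]big1 => [|w /eqP->//].
  rewrite mul1r; apply: eq_bigr => u _.
  rewrite (eq_bigr (fun=> (e u)%:R)) ?prodr_const // => w /eqP-> //.
(* The exponent [d u + (n - phi u)] equals [n] for all [u] only if [phi = d]. *)
rewrite mulr_sumr raddf_sum /= (bigD1 [ffun u => Ordinal (dn u)]) //=.
have monE (phi : {ffun U -> 'I_n.+1}) :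
    \prod_u (lam (phi u) *: 'X_(enum_rank u) ^+ (n - phi u)) =
    (\prod_u lam (phi u)) *: 'X_[[multinom (n - phi (enum_val i))%N | i < #|U|]].
  rewrite scaler_prod; congr (_ *: _).
  rewrite [RHS]mpolyXE_id [RHS](reindex enum_rank) /=; last exact/onW_bij/enum_rank_bij.
  by apply: eq_bigr => u _; rewrite mnmE enum_rankK.
rewrite [X in _ + X]big1 ?addr0 => [|phi ne].
  rewrite monE -scalerAr mcoeffZ -mpolyXD mcoeffX.
  rewrite [X in nat_of_bool X](_ : _ = true) ?mulr1.
    by apply: eq_bigr => u _; rewrite ffunE.
  apply/eqP/mnmP => i; rewrite mnmDE !mnmE ffunE /= -{1}(enum_valK i) mon_sumE.
  by rewrite subnKC //; apply: (dn (enum_val i)).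
rewrite monE -scalerAr mcoeffZ -mpolyXD mcoeffX; case: eqP => [e|]; last by rewrite mulr0.
case/eqP: ne; apply/ffunP => u; apply: val_inj; rewrite ffunE /=.
have := congr1 (fun m : 'X_{1.. #|U|} => m (enum_rank u)) e.
rewrite mnmDE mon_sumE !mnmE enum_rankK -/(d u).
by have := ltn_ord (phi u); have := dn u; lia.
Qed.

End BooleanSums.

(** * Polynomials as products of a given number of affine forms *)

Lemma affine_factors (F : closedFieldType) (B : nat) (p : {poly F}) :
    (size p <= B.+1)%N -> (0 < B)%N ->
  exists a b : 'I_B -> F, p = \prod_t (a t *: 'X + (b t)%:P).
Proof.
move=> p_size B_gt0; have [r pE] := closed_field_poly_normal p.
have [p0 | p_neq0] := eqVneq p 0.
  exists (fun=> 0), (fun=> 0); case: B B_gt0 {p_size} => // B _.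
  by rewrite big_ord_recl scale0r addr0 mul0r.
have r_size : (size r <= B)%N.
  move: p_size; rewrite pE size_scale ?lead_coef_eq0 //.
  by rewrite size_prod_XsubC.
(* The leading coefficient goes into the factor of index 0; beyond the roots the factors are padded
   with 1. *)
pose lc (t : 'I_B) := if t == 0%N :> nat then lead_coef p else 1.
exists (fun t => lc t * (t < size r)%:R),
  (fun t => lc t * (if (t < size r)%N then - r`_t else 1)).
transitivity (\prod_(t < B) (lc t)%:P *
              \prod_(t < B) (if (t < size r)%N then 'X - (r`_t)%:P else 1)).
  rewrite {1}pE -mul_polyC; congr (_ * _).
    case: B B_gt0 @lc {p_size r_size} => // B _ lc.
    by rewrite big_ord_recl big1 ?mulr1.
  rewrite -big_mkcond /= -(big_ord_widen _ (fun t => 'X - (r`_t)%:P)) //.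
  by rewrite (big_nth 0) big_mkord.
rewrite -big_split; apply: eq_bigr => t _ /=.
case: ifP => _; rewrite /= -mul_polyC.
  by rewrite mulr1 mulrN polyCN polyCM mulrBr.
by rewrite mulr0 polyC0 mul0r add0r !mulr1.
Qed.

(** Newton interpolation: the value at [B.+1] is corrected by a multiple of a product vanishing at
    [0, ..., B]. *)
Lemma nat_interpolation (F : numFieldType) (B : nat) (phi : nat -> F) :
  exists2 p : {poly F}, (size p <= B.+1)%N &
    forall i, (i <= B)%N -> p.[i%:R] = phi i.
Proof.
elim: B => [|B [p p_size pE]].
  by exists (phi 0)%:P => [|[]//]; rewrite ?size_polyC_leq1 ?hornerC.
pose q : {poly F} := \prod_(j < B.+1) ('X - (j%:R)%:P).
have qE x : q.[x] = \prod_(j < B.+1) (x - j%:R).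
  by rewrite horner_prod; apply: eq_bigr => j _; rewrite !hornerE.
have qB : q.[B.+1%:R] != 0.
  rewrite qE; apply/prodf_neq0 => j _; rewrite subr_eq0 eqr_nat.
  by rewrite gtn_eqF.
exists (p + ((phi B.+1 - p.[B.+1%:R]) / q.[B.+1%:R]) *: q).
  apply: leq_trans (size_polyD _ _) _; rewrite geq_max leqW //=.
  apply: leq_trans (size_scale_leq _ _) _; rewrite /q.
  by rewrite -(big_mkord xpredT (fun j => 'X - (j%:R)%:P)) size_prod_XsubC size_iota subn0.
move=> i; rewrite hornerD hornerZ leq_eqVlt => /orP[/eqP-> | iB].
  by rewrite divfK // addrC subrK.
by rewrite pE // (qE i%:R) (bigD1 (Ordinal iB)) //= subrr mul0r mulr0 addr0.
Qed.

Lemma constraint_factors (F : numClosedFieldType) (B : nat) (phi : pred nat) :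
    (0 < B)%N ->
  exists a b : 'I_B -> F, forall i, (i <= B)%N ->
    \prod_t (a t * i%:R + b t) = (phi i)%:R.
Proof.
move=> B_gt0; have [p p_size pE] := nat_interpolation B (fun i => (phi i)%:R : F).
have [a [b pab]] := affine_factors p_size B_gt0.
exists a, b => i iB; rewrite -pE // pab horner_prod.
by apply: eq_bigr => t _; rewrite !hornerE.
Qed.

(** * Boolean sums as projections of the hyperpfaffian *)

Lemma projection_eq (F : fieldType) (v w : nat) (P P' : {mpoly F[v]})
    (Q : {mpoly F[w]}) : projection P Q -> P = P' -> projection P' Q.
Proof. by move=> proj <-. Qed.

(** The matrix has one row for each affine form and, for each [u], the [n] rows of factors of the
    polynomial defining [lam]. Its columns are [n] copies of each [u] and [n] copies of the constant
    column. The constant does not depend on the literals, so it can be compensated by them. *)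
Lemma boolean_sum_projection (F : numClosedFieldType) (v k : nat) (U W : finType) :
    (0 < k)%N -> ~~ odd k -> (0 < #|W|)%N ->
  exists2 c : F, c != 0 & forall L : W -> option U -> literal F v,
    projection
      (c *: \sum_(e : {ffun U -> bool})
         \prod_w (lit_poly (L w None) + \sum_u (e u)%:R * lit_poly (L w (Some u))))
      (hyperpf_poly F k (#|W| * #|U|.+1)).
Proof.
move=> k_gt0 k_even W_gt0; set n := #|W|.
pose I : finType := (W + U * 'I_n)%type.
have cardI : #|I| = (n * #|U|.+1)%N.
  by rewrite card_sum card_prod card_ord mulnS mulnC.
rewrite -cardI.
have [al [be hE]] := affine_factors
  (size_poly n.+1 (fun p => if p == n then 2 else 1 : F)) W_gt0.
pose c (i : I) : option U := if i is inr (u, _) then Some u else None.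
pose K := #|[set s : 'S_#|I| | [forall i, c (enum_val (s i)) == c (enum_val i)]]|.
have K_gt0 : (0 < K)%N.
  apply/card_gt0P; exists 1%g; rewrite inE; apply/forallP => i.
  by rewrite perm1.
exists ((#|I|`!)%:R / ((2 * k * #|I|)`!)%:R * K%:R).
  by rewrite !mulf_neq0 ?invr_eq0 ?pnatr_eq0 -?lt0n ?fact_gt0.
move=> L.
pose a (i : I) (o : option U) : literal F v :=
  match i with
  | inl w => L w o
  | inr (u, t) => if o == Some u then inl (al t)
                  else if o == None then inl (be t) else inl 0
  end.
apply: (projection_eq (@permanent_projection F v k #|I|
  (fun i j => a (enum_val i) (c (enum_val j))) k_gt0 k_even)).
rewrite (sum_perm_coef (c \o enum_val) (fun i o => lit_poly (a (enum_val i) o))) /=.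
rewrite -/K -[RHS]scalerA; congr (_ *: _).
rewrite scaler_nat mulr_natl; congr (_ *+ _).
have factorE : \prod_t ((al t)%:MP *: 'X + ((be t)%:MP)%:P) =
    \poly_(p < n.+1) (if p == n then 2 else 1) :> {poly {mpoly F[v]}}.
  transitivity (map_poly (@mpolyC v F) (\poly_(p < n.+1) (if p == n then 2 else 1))).
    rewrite hE rmorph_prod; apply: eq_bigr => t _.
    by rewrite rmorphD /= linearZ /= map_polyX map_polyC.
  apply/polyP => p; rewrite coef_map !coef_poly.
  by do 2?case: ifP => _; rewrite /= ?mpolyC0 ?mpolyC1 ?mpolyC_nat.
rewrite -(boolean_sum_coef factorE (fun w o => lit_poly (L w o))).
set m := (\sum_i _)%MM.
have -> : m = [multinom n | i < #|U|].
  apply/mnmP => i; rewrite -(enum_valK i) mon_sumE mnmE -/n.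
  rewrite -sum1_card (reindex_onto enum_rank enum_val) /=; last first.
    by move=> j _; rewrite enum_valK.
  under eq_bigl => j do rewrite inE /= !enum_rankK eqxx andbT.
  rewrite big_sumType /= big_pred0 // add0n.
  rewrite (eq_bigl (fun ut : U * 'I_n => (ut.1 == enum_val i) && true)) => [|[u t]].
    rewrite -(pair_big (fun u => u == enum_val i) xpredT (fun _ _ => 1%N)) /=.
    by rewrite big_pred1_eq sum1_card card_ord.
  by rewrite andbT /= (inj_eq Some_inj).
congr (_@__); rewrite (reindex enum_rank) /=; last exact/onW_bij/enum_rank_bij.
under eq_bigr => i _ do rewrite enum_rankK.
rewrite big_sumType /=; congr (_ * _); rewrite pair_big /=.
apply: eq_bigr => -[u t] _ /=.
rewrite big_option /= (bigD1 u) //= eqxx big1 ?addr0 => [|u' ne]; first by rewrite addrC.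
by rewrite (inj_eq Some_inj) (negPf ne) /= mpolyC0 scale0r.
Qed.

(** The indicator of each constraint is a product of [B] affine forms in the bits. The one further
    row, added by the successor, is the constant [x^-1] cancelling the factor left by the
    unconstrained case. *)
Lemma constrained_sum_projection (F : numClosedFieldType) (v k B : nat)
    (U W C : finType) (L : W -> option U -> literal F v)
    (co : C -> U -> nat) (phi : C -> pred nat) :
    (0 < k)%N -> ~~ odd k -> (0 < B)%N ->
    (forall c, (\sum_u co c u <= B)%N) ->
  projection
    (\sum_(e : {ffun U -> bool} | [forall c, phi c (\sum_u co c u * e u)%N])
       \prod_w (lit_poly (L w None) + \sum_u (e u)%:R * lit_poly (L w (Some u))))
    (hyperpf_poly F k ((#|W| + #|C| * B).+1 * #|U|.+1)).
Proof.
move=> k_gt0 k_even B_gt0 co_le.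
pose W' : finType := option (W + C * 'I_B)%type.
have cardW' : #|W'| = (#|W| + #|C| * B).+1.
  by rewrite card_option card_sum card_prod card_ord.
rewrite -cardW'.
have W'_gt0 : (0 < #|W'|)%N by rewrite cardW'.
have [x x_neq0 proj] := @boolean_sum_projection F v k U W' k_gt0 k_even W'_gt0.
have /fin_all_exists[ab abE] (c : C) : exists ab : 'I_B -> F * F,
    forall i, (i <= B)%N -> \prod_t ((ab t).1 * i%:R + (ab t).2) = (phi c i)%:R.
  have [a [b ab]] := constraint_factors F (phi c) B_gt0.
  by exists (fun t => (a t, b t)).
pose L' (w : W') (o : option U) : literal F v :=
  match w, o with
  | Some (inl w), _ => L w o
  | Some (inr (c, t)), Some u => inl ((ab c t).1 * (co c u)%:R)
  | Some (inr (c, t)), None => inl (ab c t).2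
  | None, Some _ => inl 0
  | None, None => inl x^-1
  end.
apply: (projection_eq (proj L')).
rewrite [RHS]big_mkcond scaler_sumr; apply: eq_bigr => e _.
rewrite big_option /= [X in (_ + X) * _]big1 ?addr0 => [|u _]; last first.
  by rewrite mpolyC0 mulr0.
rewrite mul_mpolyC scalerA divff // scale1r.
rewrite big_sumType /= -mulrb -mulr_natr; congr (_ * _).
transitivity (\prod_c \prod_t ((ab c t).2%:MP_[v] +
    \sum_u (e u)%:R * ((ab c t).1 * (co c u)%:R)%:MP)).
  by rewrite pair_bigA; apply: eq_bigr => -[].
have valE c : \prod_t ((ab c t).2%:MP +
    \sum_u (e u)%:R * ((ab c t).1 * (co c u)%:R)%:MP) =
    (phi c (\sum_u co c u * e u)%N)%:R :> {mpoly F[v]}.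
  rewrite -[RHS]mpolyC_nat -abE; last first.
    apply: leq_trans (co_le c); apply: leq_sum => u _.
    by case: (e u); rewrite ?muln1 ?muln0.
  rewrite rmorph_prod; apply: eq_bigr => t _.
  rewrite rmorphD /= addrC; congr (_ + _).
  rewrite natr_sum mulr_sumr rmorph_sum; apply: eq_bigr => u _.
  by rewrite -mpolyC_nat -rmorphM /= natrM mulrC mulrA.
under eq_bigr => c _ do rewrite valE.
case: forallP => [all_c | /forallP/forallPn[c c_false]].
  by rewrite big1 // => c _; rewrite all_c.
by rewrite (bigD1 c) //= (negPf c_false) mul0r.
Qed.

(** * Unfolding a straight-line system *)

Section Unfolding.
Variables (A : comNzRingType) (S D top : nat) (T : finType).
Variables (V : nat -> A) (wt : nat -> T -> A) (cl : nat -> T -> seq nat).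
Variable (deg : nat -> nat).
Hypothesis top_lt : (top < S)%N.
Hypothesis V_eq : forall g, (g < S)%N ->
  V g = \sum_a wt g a * \prod_(h <- cl g a) V h.
Hypothesis cl_lt : forall g a, (g < S)%N -> all (fun h => h < g)%N (cl g a).
Hypothesis deg_gt0 : forall g, (g < S)%N -> (0 < deg g)%N.
Hypothesis deg_cl : forall g a, (g < S)%N -> (\sum_(h <- cl g a) deg h <= deg g)%N.
Hypothesis deg_top : (deg top <= D)%N.

(* In a configuration the [D] copies of each gate are either idle ([None]) or select one of the
   summands of that gate. *)
Definition config := {ffun 'I_S * 'I_D -> option T}.

Definition owt g (o : option T) : A := if o is Some a then wt g a else 1.
Definition ocl g (o : option T) : seq nat := if o is Some a then cl g a else [::].

Definition demand (f : config) (h : nat) : nat :=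
  ((h == top) + \sum_(g < S) \sum_(t < D) count_mem h (ocl g (f (g, t))))%N.

(** As the active copies are required to be the first ones, each term of the expansion corresponds
    to exactly one configuration. *)
Definition valid_config (f : config) : bool :=
  [forall gt : 'I_S * 'I_D, (f gt != None) == (gt.2 < demand f gt.1)%N].

(** The gates from [k] on have been expanded. Those below [k] are idle and still occur in
    [partial_sum] as powers of their values, with their demands as exponents. *)
Let valid_from k (f : config) : bool :=
  [forall gt : 'I_S * 'I_D, if (gt.1 < k)%N then f gt == None
                            else (f gt != None) == (gt.2 < demand f gt.1)%N].

Let partial_sum k : A :=
  \sum_(f : config | valid_from k f)
    (\prod_(gt : 'I_S * 'I_D) owt gt.1 (f gt)) * \prod_(h < k) V h ^+ demand f h.

Lemma ocl_lt g o : (g < S)%N -> all (fun h => h < g)%N (ocl g o).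
Proof. by case: o => //= a; apply: cl_lt. Qed.

Lemma ocl_deg g o : (g < S)%N ->
  (\sum_(h <- ocl g o) deg h <= (o != None) * deg g)%N.
Proof.
by case: o => [a|] gS /=; rewrite ?big_nil // mul1n deg_cl.
Qed.

Lemma prod_count k (s : seq nat) : all (fun h => h < k)%N s ->
  \prod_(h <- s) V h = \prod_(h < k) V h ^+ count_mem (h : nat) s.
Proof.
elim: s => [|x s IHs] /=; first by rewrite big_nil big1.
case/andP => xk /IHs; rewrite big_cons => ->.
under [RHS]eq_bigr => h _ do rewrite exprD.
rewrite big_split /=; congr (_ * _).
rewrite (bigD1 (Ordinal xk)) //= eqxx big1 ?mulr1 // => h ne.
have -> : (x == h) = false by apply: contraNF ne => /eqP e; apply/eqP/val_inj.
by rewrite expr0.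
Qed.

Lemma sum_count k (s : seq nat) :
  (\sum_(h < k) count_mem (h : nat) s * deg h <= \sum_(h <- s) deg h)%N.
Proof.
elim: s => [|x s IHs] /=; first by rewrite big_nil big1.
rewrite big_cons; under eq_bigr => h _ do rewrite mulnDl.
rewrite big_split leq_add //=.
case: (ltnP x k) => [xk|kx].
  rewrite (bigD1 (Ordinal xk)) //= eqxx mul1n big1 ?addn0 // => h ne.
  have -> // : (x == h) = false by apply: contraNF ne => /eqP e; apply/eqP/val_inj.
by rewrite big1 // => h _; rewrite gtn_eqF // (leq_trans (ltn_ord h)).
Qed.

Lemma sum_ltn_le d m : (\sum_(t < d) (t < m)%N <= m)%N.
Proof.
suff -> : (\sum_(t < d) (t < m)%N = minn d m)%N by exact: geq_minr.
elim: d => [|d IHd]; first by rewrite big_ord0 min0n.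
by rewrite big_ord_recr /= IHd; case: ltnP; lia.
Qed.

(** Weighted by degree, the calls come from the output, which accounts for [deg top], and from
    active copies, each accounting for at most the degree of its gate. Cancelling the gates above
    [k] leaves [demand f k * deg k <= deg top]. *)
Lemma demand_le k f : (k < S)%N -> valid_from k.+1 f -> (demand f k <= D)%N.
Proof.
move=> kS /forallP f_valid; apply: leq_trans deg_top.
have all_le : (\sum_(h < S) demand f h * deg h <=
    deg top + \sum_(g < S | (k < g)%N) demand f g * deg g)%N.
  under eq_bigr => h _ do rewrite mulnDl big_distrl /=.
  rewrite big_split /=; apply: leq_add.
    rewrite (bigD1 (Ordinal top_lt)) //= eqxx mul1n big1 ?addn0 // => h ne.
    have -> // : (h == top :> nat) = false.
    by apply: contraNF ne => /eqP e; apply/eqP/val_inj.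
  rewrite exchange_big [X in (_ <= X)%N]big_mkcond /=; apply: leq_sum => g _.
  under eq_bigr => h _ do rewrite big_distrl /=.
  rewrite exchange_big /=.
  apply: (@leq_trans (\sum_(t < D) (f (g, t) != None) * deg g)%N).
    apply: leq_sum => t _; apply: leq_trans (sum_count _ _) _; exact: ocl_deg.
  rewrite -big_distrl /=; case: ifP => kg.
    rewrite leq_mul2r (leq_trans _ (sum_ltn_le D (demand f g))) ?orbT //.
    apply: leq_sum => t _; have := f_valid (g, t); rewrite /= ltnS leqNgt kg /=.
    by move/eqP->.
  rewrite big1 // => t _; have := f_valid (g, t); rewrite /= ltnS leqNgt kg /=.
  by move/eqP->.
move: all_le; rewrite (bigID (fun h : 'I_S => (k < h)%N)) /= addnC leq_add2r.
apply: leq_trans; rewrite (bigD1 (Ordinal kS)) /= ?ltnn //.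
apply: leq_trans (leq_addr _ _); rewrite -{1}[demand f k]muln1 leq_mul2l.
by rewrite deg_gt0 ?orbT.
Qed.

(** Each of the first [m] copies contributes the defining sum of [V k]; the idle ones contribute
    1. *)
Lemma expand_power k m : (k < S)%N -> (m <= D)%N ->
  V k ^+ m = \sum_(al : {ffun 'I_D -> option T} |
                   [forall t, (al t != None) == (t < m)%N])
    (\prod_t owt k (al t)) *
    \prod_(h < k) V h ^+ (\sum_t count_mem (h : nat) (ocl k (al t))).
Proof.
move=> kS mD; pose G o := owt k o * \prod_(h <- ocl k o) V h.
transitivity (\prod_(t < D) \sum_(o | (o != None) == (t < m)%N) G o).
  rewrite -{1}(card_ord m) -prodr_const (big_ord_widen _ (fun=> V k) mD).
  rewrite big_mkcond; apply: eq_bigr => t _; rewrite big_mkcond big_option /=.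
  case: ifP => tm /=; first by rewrite add0r; apply: V_eq.
  by rewrite big1 // addr0 /G /= big_nil mulr1.
rewrite bigA_distr_big_dep; apply: eq_big => [al | al _].
  by apply/familyP/forallP => H t; have := H t; rewrite unfold_in.
rewrite big_split /=; congr (_ * _).
under [RHS]eq_bigr => h _ do rewrite expr_sum.
rewrite exchange_big; apply: eq_bigr => t _.
by apply: prod_count; apply: ocl_lt.
Qed.

Let upd (k : 'I_S) (f : config) (al : {ffun 'I_D -> option T}) : config :=
  [ffun gt => if gt.1 == k then al gt.2 else f gt].

Lemma demand_upd (k : 'I_S) (f : config) al h : (forall t, f (k, t) = None) ->
  demand (upd k f al) h = (demand f h + \sum_t count_mem h (ocl k (al t)))%N.
Proof.
move=> f_none; rewrite /demand -addnA; congr (_ + _)%N.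
rewrite (bigD1 k) //= [in RHS](bigD1 k) //= [X in (_ = X + _ + _)%N]big1 => [|t _].
  rewrite add0n addnC; congr (_ + _)%N; last first.
    by apply: eq_bigr => t _; rewrite ffunE /= eqxx.
  apply: eq_bigr => g gk; apply: eq_bigr => t _.
  by rewrite ffunE /= (negPf gk).
by rewrite f_none.
Qed.

(** Gate [k] calls only gates strictly below it. *)
Lemma demand_upd_ge (k : 'I_S) (f : config) al h : (forall t, f (k, t) = None) ->
  (k <= h)%N -> demand (upd k f al) h = demand f h.
Proof.
move=> f_none kh; rewrite demand_upd // big1 ?addn0 // => t _.
apply/count_memPn; apply/negP => h_in.
by have /allP/(_ _ h_in) := ocl_lt (al t) (ltn_ord k); rewrite ltnNge kh.
Qed.

(** Expanding the power of [V k] chooses summands for the copies of gate [k], which were idle; the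
    new calls multiply the powers of the lower gates. *)
Lemma partial_sum_step k : (k < S)%N -> partial_sum k.+1 = partial_sum k.
Proof.
move=> kS; pose kk := Ordinal kS.
pose none : {ffun 'I_D -> option T} := [ffun=> None].
have valid_none (f : config) t : valid_from k.+1 f -> f (kk, t) = None.
  by move=> /forallP/(_ (kk, t)); rewrite /= ltnSn => /eqP.
have ltkS (g : 'I_S) : (g < k.+1)%N = (g == k :> nat) || (g < k)%N.
  by rewrite ltnS leq_eqVlt.
apply: esym; rewrite /partial_sum.
rewrite (reindex_onto (fun p : config * {ffun 'I_D -> option T} => upd kk p.1 p.2)
           (fun f : config => (upd kk f none, [ffun t => f (kk, t)]))) /=; last first.
  move=> f _; apply/ffunP => -[g t]; rewrite !ffunE /=.
  by case: eqP => [->|//].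
rewrite (eq_bigl (fun p : config * {ffun 'I_D -> option T} =>
  valid_from k.+1 p.1 && [forall t, (p.2 t != None) == (t < demand p.1 k)%N])); last first.
  case=> f al /=; apply/andP/andP => [[/forallP v /eqP[e1 e2]] | [v /forallP al_v]].
    have f_none t : f (kk, t) = None by rewrite -e1 !ffunE /= eqxx.
    split; last first.
      apply/forallP => t; have := v (kk, t).
      by rewrite /= ltnn ffunE /= eqxx demand_upd_ge.
    apply/forallP => -[g t]; have := v (g, t); rewrite /= ltkS ffunE /=.
    have -> : (g == kk) = (g == k :> nat) by [].
    case: (eqVneq (g : nat) k) => [gk|_] /=.
      by move=> _; apply/eqP; have -> : g = kk; [apply: val_inj | apply: f_none].
    by case: ltnP => // kg; rewrite demand_upd_ge.
  have f_none t : f (kk, t) = None by apply: valid_none.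
  move/forallP: v => v; split.
    apply/forallP => -[g t]; rewrite /= ffunE /=.
    have -> : (g == kk) = (g == k :> nat) by [].
    have := v (g, t); rewrite /= ltkS; case: (eqVneq (g : nat) k) => [gk | _] /=.
      by rewrite gk ltnn demand_upd_ge // => _; apply: al_v.
    by case: ltnP => // kg; rewrite demand_upd_ge.
  apply/eqP; congr (_, _); apply/ffunP; last by move=> t; rewrite !ffunE /= eqxx.
  by move=> [g t]; rewrite !ffunE /=; case: eqP => [->|//]; rewrite f_none.
rewrite -(pair_big_dep (valid_from k.+1)
  (fun f (al : {ffun 'I_D -> option T}) => [forall t, (al t != None) == (t < demand f k)%N])
  (fun f al => (\prod_(gt : 'I_S * 'I_D) owt gt.1 (upd kk f al gt)) *
                \prod_(h < k) V h ^+ demand (upd kk f al) h)) /=.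
apply: eq_bigr => f f_valid.
have f_none t : f (kk, t) = None by apply: valid_none.
rewrite big_ord_recr /= (expand_power kS (demand_le kS f_valid)).
rewrite !mulr_sumr; apply: eq_bigr => al _.
have -> : \prod_(gt : 'I_S * 'I_D) owt gt.1 (upd kk f al gt) =
    (\prod_(gt : 'I_S * 'I_D) owt gt.1 (f gt)) * \prod_t owt k (al t).
  pose P (f : config) g t := owt (g : 'I_S) (f (g, t)).
  have prodE (f' : config) : \prod_(gt : 'I_S * 'I_D) owt gt.1 (f' gt) = \prod_g \prod_t P f' g t.
    by rewrite pair_bigA; apply: eq_bigr => -[].
  rewrite !prodE (bigD1 kk) //= [X in _ = X * _](bigD1 kk) //=.
  rewrite [X in _ = X * _ * _]big1 ?mul1r => [|t _]; last by rewrite /P f_none.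
  rewrite mulrC; congr (_ * _).
    apply: eq_bigr => g gk; apply: eq_bigr => t _.
    by rewrite /P ffunE /= (negPf gk).
  by apply: eq_bigr => t _; rewrite /P ffunE /= eqxx.
under [X in _ * X = _]eq_bigr => h _ do rewrite demand_upd // exprD.
rewrite big_split /= !mulrA; congr (_ * _).
by rewrite -!mulrA; congr (_ * _); rewrite mulrC.
Qed.

(** The sum at stage [S] has only the idle configuration and equals [V top]; at stage 0 no value
    [V h] is left. *)
Theorem unfold_system :
  V top = \sum_(f : config | valid_config f) \prod_(gt : 'I_S * 'I_D) owt gt.1 (f gt).
Proof.
have sumE k : (k <= S)%N -> partial_sum S = partial_sum (S - k).
  elim: k => [|k IHk] kS; first by rewrite subn0.
  by rewrite (IHk (ltnW kS)) -subSS subSn // partial_sum_step //; lia.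
transitivity (partial_sum S); last first.
  rewrite (sumE S) // subnn; apply: eq_bigr => f _.
  by rewrite big_ord0 mulr1.
rewrite /partial_sum (big_pred1 [ffun=> None]) => [|f].
  rewrite big1 ?mul1r => [|gt _]; last by rewrite ffunE.
  rewrite (bigD1 (Ordinal top_lt)) //= big1 => [|h ne].
    rewrite mulr1 /demand eqxx big1 ?expr1 // => g _.
    by rewrite big1 // => t _; rewrite ffunE.
  rewrite /demand big1 => [|g _]; last by rewrite big1 // => t _; rewrite ffunE.
  have -> : (h == top :> nat) = false.
    by apply: contraNF ne => /eqP e; apply/eqP/val_inj.
  by rewrite expr0.
apply/forallP/eqP => [v | -> gt]; last by rewrite ltn_ord ffunE.
by apply/ffunP => gt; have := v gt; rewrite ltn_ord ffunE => /eqP.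
Qed.

End Unfolding.

(** * Homogeneous components *)

Section Homogeneous.
Variables (F : fieldType) (w : nat).
Implicit Type p : {mpoly F[w]}.

(** Substitutes [X_i T] for [X_i], so that the coefficient of [T^i] is the homogeneous component of
    degree [i]. Being a ring morphism, it yields the rules for sums and products at once. *)
Definition grade : {mpoly F[w]} -> {poly {mpoly F[w]}} :=
  mmap (polyC \o mpolyC w (R := F)) (fun i => ('X_i)%:P * 'X).

Definition hpart (i : nat) p : {mpoly F[w]} := (grade p)`_i.

Lemma gradeE p :
  grade p = \sum_(m <- msupp p) (p@_m *: 'X_[m])%:P * 'X^(mdeg m).
Proof.
apply: eq_bigr => m _; rewrite /= -mul_mpolyC polyCM -mulrA; congr (_ * _).
rewrite /mmap1; under eq_bigr => i _ do rewrite exprMn -rmorphXn.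
rewrite big_split /= -rmorph_prod /= -mpolyXE_id mdegE.
by congr (_ * _); rewrite -expr_sum.
Qed.

Lemma hpartE i p :
  hpart i p = \sum_(m <- msupp p) (p@_m *: 'X_[m]) * (i == mdeg m)%:R.
Proof.
rewrite /hpart gradeE coef_sum; apply: eq_bigr => m _.
by rewrite coefCM coefXn.
Qed.

Lemma hpart0 p : hpart 0 p = (p@_0)%:MP.
Proof.
rewrite hpartE; have [p0|p0] := boolP (0%MM \in msupp p); last first.
  rewrite (memN_msupp_eq0 p0) mpolyC0 big_seq big1 // => m m_in.
  rewrite eq_sym mdeg_eq0; case: eqP => [e|]; last by rewrite mulr0.
  by rewrite -e m_in in p0.
rewrite (bigD1_seq _ p0) ?msupp_uniq //= mdeg0 eqxx mulr1 mpolyX0 alg_mpolyC.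
rewrite big1 ?addr0 // => m m_neq0.
by rewrite eq_sym mdeg_eq0 (negPf m_neq0) mulr0.
Qed.

Lemma sum_hpart d p : (msize p <= d)%N -> \sum_(i < d) hpart i p = p.
Proof.
move=> pd; under eq_bigr => i _ do rewrite hpartE.
rewrite exchange_big {3}[p]mpolyE big_seq [RHS]big_seq; apply: eq_bigr => m m_in.
have md : (mdeg m < d)%N by apply: leq_trans (msize_mdeg_lt m_in) pd.
rewrite -mulr_sumr (bigD1 (Ordinal md)) //= eqxx big1 ?addr0 ?mulr1 // => i ne.
by case: eqP => // e; case/eqP: ne; apply: val_inj.
Qed.

Lemma hpartD i p q : hpart i (p + q) = hpart i p + hpart i q.
Proof. by rewrite /hpart /grade rmorphD /= coefD. Qed.

Lemma hpartM i p q :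
  hpart i (p * q) = \sum_(j < i.+1) hpart j p * hpart (i - j) q.
Proof. by rewrite /hpart /grade rmorphM /= coefM. Qed.

Lemma hpartC i a : hpart i a%:MP = if i == 0%N then a%:MP else 0.
Proof. by rewrite /hpart /grade mmapC /= coefC. Qed.

Lemma hpartX i j : hpart i 'X_j = if i == 1%N then 'X_j else 0.
Proof.
rewrite /hpart /grade mmapX mmap1U coefCM coefX.
by case: eqP => _; rewrite ?mulr1 ?mulr0.
Qed.

End Homogeneous.

(** * Circuits as straight-line systems *)

Section CircuitPolys.
Variables (F : fieldType) (w : nat).
Implicit Type c : circuit F w.

Lemma circuit_polys_rcons c G :
  circuit_polys (rcons c G) = rcons (circuit_polys c) (gate_poly (circuit_polys c) G).
Proof. by rewrite /circuit_polys -cats1 foldl_cat. Qed.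

Lemma size_circuit_polys c : size (circuit_polys c) = size c.
Proof.
by elim/last_ind: c => // c G IHc; rewrite circuit_polys_rcons !size_rcons IHc.
Qed.

Lemma circuit_wf_from_cat pos c c' :
  circuit_wf_from pos (c ++ c') =
  circuit_wf_from pos c && circuit_wf_from (pos + size c) c'.
Proof.
elim: c pos => [|G c IHc] pos /=; first by rewrite addn0.
by rewrite IHc addSnnS andbA.
Qed.

Lemma circuit_wf_rcons c G :
  circuit_wf (rcons c G) = circuit_wf c && gate_wf (size c) G.
Proof. by rewrite /circuit_wf -cats1 circuit_wf_from_cat /= andbT. Qed.

(** A well-formed gate reads only earlier positions, whose values later gates leave unchanged. Past
    the end the default gate, the constant 0, matches the default value 0. *)
Lemma circuit_gate c q : circuit_wf c ->
  let G := nth (GConst w 0) c q in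
  gate_wf q G /\ (circuit_polys c)`_q = gate_poly (circuit_polys c) G.
Proof.
move=> c_wf /=; have [qc|cq] := ltnP q (size c); last first.
  by rewrite !nth_default ?size_circuit_polys //= mpolyC0.
elim/last_ind: c c_wf qc => // c G IHc.
rewrite circuit_wf_rcons => /andP[c_wf G_wf]; rewrite size_rcons ltnS circuit_polys_rcons.
have poly_mono G' : gate_wf (size c) G' ->
    gate_poly (rcons (circuit_polys c) (gate_poly (circuit_polys c) G)) G' =
    gate_poly (circuit_polys c) G'.
  by case: G' => //= i j /andP[ic jc]; rewrite !nth_rcons size_circuit_polys ic jc.
rewrite leq_eqVlt => /orP[/eqP-> | qc].
  by rewrite !nth_rcons size_circuit_polys ltnn eqxx poly_mono.
rewrite !nth_rcons size_circuit_polys qc; have [wf ->] := IHc c_wf qc.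
rewrite poly_mono //; move: wf; case: (nth _ _ _) => //= i j /andP[ic jc].
- by rewrite !(ltn_trans _ qc).
- by rewrite !(ltn_trans _ qc).
Qed.

End CircuitPolys.

Section CircuitSystem.
Variables (F : fieldType) (w s d out : nat) (c : circuit F w).
Hypothesis c_wf : circuit_wf c.
Hypothesis out_lt : (out < s)%N.
Let P q := (circuit_polys c)`_q.
Hypothesis out_size : (msize (P out) <= d.+1)%N.
Hypothesis d_gt0 : (0 < d)%N.

Let idx q i := (q * d + i.-1)%N.
Let cst q := (P q)@_0.

(* Gate [q * d + i.-1] is the component of degree [i] of gate [q] of the circuit, for
   [0 < i <= d]; gate [s * d] is the output. Components of degree zero are constants and go into
   the weights, so that every gate has positive degree. *)
Definition circuit_term (x : nat) (a : 'I_d.+1) : literal F w * seq nat :=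
  if x == (s * d)%N then
    if a == 0%N :> nat then (inl (cst out), [::]) else (inl 1, [:: idx out a])
  else let i := (x %% d).+1 in
    match nth (GConst w 0) c (x %/ d) with
    | GVar j => if (a == 0%N :> nat) && (i == 1%N) then (inr j, [::]) else (inl 0, [::])
    | GConst _ => (inl 0, [::])
    | GAdd l r => if a == 0%N :> nat then (inl 1, [:: idx l i])
                  else if a == 1%N :> nat then (inl 1, [:: idx r i])
                  else (inl 0, [::])
    | GMul l r => if a == 0%N :> nat then (inl (cst l), [:: idx r i])
                  else if (a < i)%N then (inl 1, [:: idx l a; idx r (i - a)])
                  else if a == i :> nat then (inl (cst r), [:: idx l i])
                  else (inl 0, [::])
    end.

Definition circuit_val x : {mpoly F[w]} :=
  if x == (s * d)%N then P out else hpart (x %% d).+1 (P (x %/ d)).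

Definition circuit_deg x : nat := if x == (s * d)%N then d else (x %% d).+1.

Let idxP q i : (q < s)%N -> (0 < i <= d)%N ->
  [/\ (idx q i < s * d)%N, (idx q i %/ d = q)%N & ((idx q i %% d).+1 = i)%N].
Proof.
case: i => // i qs id; rewrite /idx /= divnMDl // modnMDl divn_small // modn_small //.
split=> //; rewrite ?addn0 //; apply: (@leq_trans (q.+1 * d)%N).
  by rewrite mulSn addnC ltn_add2r.
by rewrite leq_mul2r qs orbT.
Qed.

Let val_idx q i : (q < s)%N -> (0 < i <= d)%N -> circuit_val (idx q i) = hpart i (P q).
Proof.
move=> qs id; have [lt dq mi] := idxP qs id.
by rewrite /circuit_val (ltn_eqF lt) dq mi.
Qed.

Let deg_idx q i : (q < s)%N -> (0 < i <= d)%N -> circuit_deg (idx q i) = i.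
Proof.
by move=> qs id; have [lt _ mi] := idxP qs id; rewrite /circuit_deg (ltn_eqF lt) mi.
Qed.

Let gate_lt x : (x < (s * d).+1)%N -> x != (s * d)%N -> (x %/ d < s)%N.
Proof. by rewrite ltnS leq_eqVlt => /orP[->//|xs] _; rewrite ltn_divLR. Qed.

Let mod_lt x : (0 < (x %% d).+1 <= d)%N.
Proof. by rewrite /= ltn_mod. Qed.

Let idx_lt x q i : (q < x %/ d)%N -> (0 < i <= d)%N -> (idx q i < x)%N.
Proof.
move=> qx id; rewrite [X in (_ < X)%N](divn_eq x d).
apply: leq_trans (leq_addr _ _); apply: (@leq_trans (q.+1 * d)%N).
  by rewrite /idx mulSn addnC ltn_add2r; case: i id.
by rewrite leq_mul2r qx orbT.
Qed.

Lemma circuit_term_lt x a : (x < (s * d).+1)%N ->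
  all (fun h => h < x)%N (circuit_term x a).2.
Proof.
move=> xS; rewrite /circuit_term; case: eqVneq => [-> | x_ne].
  case: eqVneq => //= a_neq0; rewrite andbT.
  have [] // := @idxP out a out_lt; rewrite lt0n a_neq0 /=.
  by rewrite -ltnS.
have [/= G_wf _] := circuit_gate (x %/ d) c_wf; have id := mod_lt x.
case: (nth _ _ _) G_wf => [j|b|l r|l r] //=; first by case: ifP.
  by case/andP => lx rx; do 2?case: ifP => //= _; rewrite ?idx_lt.
case/andP => lx rx; case: eqVneq => [_|a_neq0] /=; first by rewrite idx_lt.
have a_gt0 : (0 < a)%N by rewrite lt0n.
case: ltnP => /= [ai | ia]; last by case: ifP; rewrite //= idx_lt.
have mi : (x %% d < d)%N by rewrite ltn_mod.
by rewrite !idx_lt //; lia.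
Qed.

Lemma circuit_term_deg x a : (x < (s * d).+1)%N ->
  (\sum_(h <- (circuit_term x a).2) circuit_deg h <= circuit_deg x)%N.
Proof.
move=> xS; rewrite {2}/circuit_deg /circuit_term; case: eqVneq => [_ | x_ne].
  case: eqVneq => [_|a_neq0] /=; rewrite ?big_nil // big_seq1 deg_idx //.
    by rewrite -ltnS.
  by rewrite lt0n a_neq0 -ltnS /=.
have [/= G_wf _] := circuit_gate (x %/ d) c_wf; have id := mod_lt x.
have mi : (x %% d < d)%N by rewrite ltn_mod.
have qs := gate_lt xS x_ne; have lt_s q : (q < x %/ d -> q < s)%N.
  by move=> qx; apply: ltn_trans qs.
case: (nth _ _ _) G_wf => [j|b|l r|l r] /=; rewrite ?big_nil //.
- by case: ifP; rewrite big_nil.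
- case/andP => /lt_s ls /lt_s rs; case: ifP => _; first by rewrite big_seq1 deg_idx.
  by case: ifP => _; rewrite ?big_nil // big_seq1 deg_idx.
case/andP => /lt_s ls /lt_s rs; case: eqVneq => [_|a_neq0] /=.
  by rewrite big_seq1 deg_idx.
have a_gt0 : (0 < a)%N by rewrite lt0n.
case: ltnP => /= [ai | ia]; last by case: ifP => _; rewrite ?big_nil // big_seq1 deg_idx.
by rewrite big_cons big_seq1 !deg_idx //; lia.
Qed.

Lemma circuit_term_size x a : (size (circuit_term x a).2 <= 2)%N.
Proof.
rewrite /circuit_term; case: ifP => _; first by case: ifP.
by case: (nth _ _ _) => [j|b|l r|l r]; do 3?case: ifP => _.
Qed.

(** The output is the sum of its components. A component of a product is a convolution, whose two
    end terms have a factor of degree zero that has become a weight. *)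
Lemma circuit_val_eq x : (x < (s * d).+1)%N ->
  circuit_val x = \sum_a lit_poly (circuit_term x a).1 *
                         \prod_(h <- (circuit_term x a).2) circuit_val h.
Proof.
move=> xS; rewrite {1}/circuit_val /circuit_term; case: eqVneq => [_ | x_ne].
  rewrite -{1}(sum_hpart out_size); apply: eq_bigr => a _.
  case: eqVneq => [-> | a_neq0] /=; first by rewrite big_nil mulr1 hpart0.
  rewrite big_seq1 mpolyC1 mul1r val_idx //.
  by rewrite lt0n a_neq0 -ltnS /=.
have [/= G_wf PE] := circuit_gate (x %/ d) c_wf; have id := mod_lt x.
have qs := gate_lt xS x_ne; have lt_s q : (q < x %/ d -> q < s)%N.
  by move=> qx; apply: ltn_trans qs.
rewrite {1}/P PE; set i := (x %% d).+1 in id *.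
case: (nth _ _ _) G_wf => [j|b|l r|l r] /=.
- move=> _; rewrite big_ord_recl [X in _ + X]big1 => [|a _]; last by rewrite lift0 /= mpolyC0 mul0r.
  by rewrite /= hpartX addr0; case: eqP => _ /=; rewrite ?big_nil ?mulr1 //.
- by move=> _; rewrite big1 ?hpartC // => a _; rewrite mpolyC0 mul0r.
- case/andP => /lt_s ls /lt_s rs; rewrite hpartD.
  rewrite big_ord_recl; case: (d) d_gt0 => // d' _.
  rewrite big_ord_recl [X in _ = _ + (_ + X)]big1 => [|a _].
    by rewrite /= !big_seq1 mpolyC1 !mul1r addr0 !val_idx.
  by rewrite !lift0 /= mpolyC0 mul0r.
case/andP => /lt_s ls /lt_s rs; rewrite hpartM.
have id' : (i <= d)%N by case/andP: id.
rewrite (big_ord_widen d.+1 (fun j : nat => hpart j _ * hpart (i - j) _)) //.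
rewrite big_mkcond; apply: eq_bigr => a _.
case: eqVneq => [-> | a_neq0] /=.
  by rewrite big_seq1 val_idx // hpart0 subn0.
have a_gt0 : (0 < a)%N by rewrite lt0n.
rewrite ltnS leq_eqVlt; case: (ltngtP a i) => [ai|ia|->] /=.
- by rewrite big_cons big_seq1 mpolyC1 mul1r !val_idx //; lia.
- by rewrite big_nil mpolyC0 mul0r.
by rewrite big_seq1 subnn hpart0 val_idx // mulrC.
Qed.

End CircuitSystem.

(** * Configurations as constrained Boolean sums *)

Lemma one_hotP (B : finType) (e : pred B) :
  (\sum_b e b = 1)%N -> exists b0, forall b, e b = (b == b0).
Proof.
move=> e1; have /mem_card1[b0 b0E] : #|[pred b | e b]| = 1%N.
  by rewrite -sum1_card -e1 big_mkcond; apply: eq_bigr => b _; rewrite inE; case: (e b).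
by exists b0 => b; have := b0E b; rewrite !inE.
Qed.

Lemma sum_one_hot (A B : finType) (f : A -> B) (G : A -> B -> nat) :
  (\sum_(p : A * B) G p.1 p.2 * (f p.1 == p.2) = \sum_a G a (f a))%N.
Proof.
rewrite -(pair_bigA _ (fun a b => G a b * (f a == b))%N); apply: eq_bigr => a _.
rewrite (bigD1 (f a)) //= eqxx muln1 big1 ?addn0 // => b ne.
by rewrite eq_sym (negPf ne) muln0.
Qed.

(** There are [W] copies of gates, hence [W] affine factors; [U] bits, namely a one-hot choice for
    each copy and the [u] summation variables; and three kinds of constraints, each costing
    [5 * U + 1] factors. *)
Definition hardness_size (S D T u : nat) : nat :=
  let W := (S * D)%N in
  let U := (W * T.+1 + u)%N in
  ((W + (W + W + W * T) * (5 * U).+1).+1 * U.+1)%N.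

Section Encoding.
Variables (F : numClosedFieldType) (v u k S D top : nat) (T : finType).
Variable (term : nat -> T -> literal F (v + u) * seq nat).
Hypothesis term_size : forall g a, (size (term g a).2 <= 2)%N.
Hypotheses (k_gt0 : (0 < k)%N) (k_even : ~~ odd k).

Let W : finType := ('I_S * 'I_D)%type.
Let U : finType := (W * option T + 'I_u)%type.
Let C : finType := (W + W + W * T)%type.
Let ch := fun g a => (term g a).2.
Let B := (5 * #|U|).+1.

(** A weight may be a summation variable, and its product with the selection bit would not be
    affine. Such a weight is therefore replaced by 1 in [plain], and a constraint forces its bit to
    be 1 whenever the summand is selected. *)
Let guard g a : option 'I_u :=
  if (term g a).1 is inr j then
    if split j is inr b then Some b else None
  else None.

Let plain g (o : option T) : literal F v :=
  if o is Some a then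
    match (term g a).1 with
    | inl x => inl x
    | inr j => if split j is inl i then inr i else inl 1
    end
  else inl 1.

(** The first kind of constraint says that a copy makes exactly one choice. In the second, the
    parity of the sum tells whether the copy is idle and its half counts the calls to the gate. In
    the third, the sum is 1 exactly if a guarded summand is selected while its bit is 0. *)
Let co (c : C) (x : U) : nat :=
  match c, x with
  | inl (inl w), inl (w', o) => w' == w
  | inl (inr w), inl (w', o) =>
      (((w' == w) && (o == None)) + 2 * count_mem (w.1 : nat) (ocl ch w'.1 o))%N
  | inr (w, a), inl (w', o) => [&& w' == w, o == Some a & guard w.1 a != None]
  | inr (w, a), inr b => (2 * (guard w.1 a == Some b))%N
  | inl _, inr _ => 0%N
  end.

Let phi (c : C) : pred nat :=
  match c with
  | inl (inl _) => fun A => A == 1%N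
  | inl (inr w) => fun A => odd A == ~~ (w.2 < (w.1 == top :> nat) + A./2)%N
  | inr _ => fun A => A != 1%N
  end.

Let L (w : W) (x : option U) : literal F v :=
  if x is Some (inl (w', o)) then
    if w' == w then plain w.1 o else inl 0
  else inl 0.

Let subst (e : {ffun 'I_u -> bool}) : (v + u).-tuple {mpoly F[v]} :=
  [tuple match split i with inl j => 'X_j | inr j => (e j)%:R end | i < v + u].

Let weight g a : {mpoly F[v + u]} := lit_poly (term g a).1.

Let encode (p : config S D T * {ffun 'I_u -> bool}) : {ffun U -> bool} :=
  [ffun x : U => match x with inl (w, o) => p.1 w == o | inr b => p.2 b end].

Let co_le c : (\sum_x co c x <= B)%N.
Proof.
(* The largest coefficient is 5: the idle bit, plus twice the at most two calls of a summand. *)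
apply: (@leq_trans (\sum_(x : U) 5)%N); last first.
  by rewrite sum_nat_const mulnC leqnSn.
apply: leq_sum => x _; case: c => [[w|w]|[w a]]; case: x => [[w' o]|b] //=.
- by case: eqP.
- have : (count_mem (w.1 : nat) (ocl ch w'.1 o) <= 2)%N.
    apply: leq_trans (count_size _ _) _; case: o => //= a; exact: term_size.
  by case: (_ && _) => /=; lia.
- by case: (_ && _).
by case: (_ == _).
Qed.

Let sum_encode (G : U -> nat) f e :
  (\sum_x G x * encode (f, e) x =
   \sum_w G (inl (w, f w)) + \sum_b G (inr b) * e b)%N.
Proof.
rewrite big_sumType /=; congr (_ + _)%N.
  rewrite -(sum_one_hot f (fun w o => G (inl (w, o)))).
  by apply: eq_bigr => -[w o] _; rewrite ffunE.
by apply: eq_bigr => b _; rewrite ffunE.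
Qed.

Let satisfied (e : {ffun 'I_u -> bool}) g (o : option T) : bool :=
  if o is Some a then if guard g a is Some b then e b else true else true.

Let guarded (f : config S D T) (e : {ffun 'I_u -> bool}) :=
  [forall w : W, satisfied e w.1 (f w)].

Let phi_encode f e :
  [forall c, phi c (\sum_x co c x * encode (f, e) x)%N] =
  valid_config top ch f && guarded f e.
Proof.
have onehotE w : (\sum_x co (inl (inl w)) x * encode (f, e) x = 1)%N.
  rewrite sum_encode /= big1_eq addn0 (bigD1 w) //= eqxx big1 //.
  by move=> w' /negPf->.
have activeE w : (\sum_x co (inl (inr w)) x * encode (f, e) x)%N =
    ((f w == None) + 2 * \sum_(g < S) \sum_(t < D)
       count_mem (w.1 : nat) (ocl ch g (f (g, t))))%N.
  rewrite sum_encode /= [X in (_ + X)%N]big1_eq addn0 big_split /=; congr (_ + _)%N.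
    by rewrite (bigD1 w) //= eqxx big1 ?addn0 // => w' /negPf->.
  by rewrite -big_distrr /= pair_bigA; congr (_ * _)%N; apply: eq_bigr => -[].
have guardE w a : (\sum_x co (inr (w, a)) x * encode (f, e) x)%N =
    (((f w == Some a) && (guard w.1 a != None)) +
     2 * (if guard w.1 a is Some b then e b else false))%N.
  rewrite sum_encode /=; congr (_ + _)%N.
    by rewrite (bigD1 w) //= eqxx big1 ?addn0 // => w' /negPf->.
  case: (guard w.1 a) => [b|]; last by rewrite big1.
  rewrite (bigD1 b) //= eqxx big1 ?addn0 // => b' ne.
  by rewrite (inj_eq Some_inj) eq_sym (negPf ne).
apply/forallP/andP => [H | [/forallP f_valid /forallP f_guard]].
  split; apply/forallP => w.
    have /= := H (inl (inr w)); rewrite activeE oddD oddM /= addbF.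
    rewrite (_ : (_ + 2 * _)./2 = \sum_(g < S) \sum_(t < D)
       count_mem (w.1 : nat) (ocl ch g (f (g, t))))%N; last first.
      by rewrite mul2n half_bit_double.
    by rewrite oddb /demand; case: (f w == None); case: ltnP.
  rewrite /satisfied; case fw: (f w) => [a|] //; case ga: (guard w.1 a) => [b|] //.
  have /= := H (inr (w, a)); rewrite guardE fw ga eqxx /=.
  by case: (e b).
case=> [[w|w]|[w a]] /=; first by rewrite onehotE.
  rewrite activeE oddD oddM /= addbF.
  rewrite (_ : (_ + 2 * _)./2 = \sum_(g < S) \sum_(t < D)
     count_mem (w.1 : nat) (ocl ch g (f (g, t))))%N; last first.
    by rewrite mul2n half_bit_double.
  have := f_valid w; rewrite oddb /demand.
  by case: (f w == None); case: ltnP.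
rewrite guardE; case: (f w =P Some a) => [fw|_].
  by have := f_guard w; rewrite fw /satisfied; case: (guard w.1 a) => [b /= ->|].
by case: (guard w.1 a) => [b|] //; case: (e b).
Qed.

Let prod_encode (f : config S D T) e :
  \prod_w (lit_poly (L w None) +
           \sum_x (encode (f, e) x)%:R * lit_poly (L w (Some x))) =
  \prod_(w : W) lit_poly (plain w.1 (f w)).
Proof.
apply: eq_bigr => w _; rewrite /= mpolyC0 add0r big_sumType /=.
rewrite [X in _ + X]big1 ?addr0 => [|b _]; last by rewrite mulr0.
rewrite (bigD1 (w, f w)) //= ffunE !eqxx mul1r big1 ?addr0 // => -[w' o] ne.
rewrite ffunE /=; case: (w' =P w) ne => [-> | _ _]; last by rewrite mulr0.
by rewrite xpair_eqE eqxx /= eq_sym => /negPf->; rewrite mul0r.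
Qed.

Let subst_weight e g o :
  owt weight g o \mPo subst e =
  lit_poly (plain g o) * (satisfied e g o)%:R.
Proof.
case: o => [a|] /=; last by rewrite comp_mpoly1 mpolyC1 mulr1.
rewrite /satisfied /weight /guard; case: (term g a).1 => [x|j] /=.
  by rewrite comp_mpolyC mulr1.
rewrite comp_mpolyXU -tnth_nth tnth_mktuple.
by case: (split j) => [i|b] /=; rewrite ?mulr1 // mpolyC1 mul1r.
Qed.

Let prod_subst (f : config S D T) e :
  (\prod_(w : W) owt weight w.1 (f w)) \mPo subst e =
  if guarded f e then \prod_(w : W) lit_poly (plain w.1 (f w)) else 0.
Proof.
rewrite rmorph_prod /=; under eq_bigr => w _ do rewrite subst_weight.
rewrite big_split /= /guarded; case: forallP => [f_guard | /forallP/forallPn[w not_w]].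
  by rewrite [X in _ * X]big1 ?mulr1 // => w _; rewrite f_guard.
by rewrite [X in _ * X](bigD1 w) //= (negPf not_w) mul0r mulr0.
Qed.

Let decode (e : {ffun U -> bool}) : config S D T * {ffun 'I_u -> bool} :=
  ([ffun w => odflt None [pick o | e (inl (w, o))]], [ffun b => e (inr b)]).

Let encodeK p : decode (encode p) = p.
Proof.
case: p => f e; congr (_, _); apply/ffunP; last by move=> b; rewrite !ffunE.
move=> w; rewrite !ffunE.
case: pickP => [o | /(_ (f w))]; rewrite ffunE /= ?eqxx //.
by move/eqP.
Qed.

Let decodeK (e : {ffun U -> bool}) : (forall w, \sum_x co (inl (inl w)) x * e x = 1)%N ->
  encode (decode e) = e.
Proof.
move=> e1; apply/ffunP => -[[w o]|b]; rewrite !ffunE //=.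
have /one_hotP[o0 o0E] : (\sum_o e (inl (w, o)) = 1)%N.
  rewrite -[RHS](e1 w) big_sumType /= [X in (_ + X)%N]big1_eq addn0.
  transitivity (\sum_w' \sum_o (w' == w) * e (inl (w', o)))%N.
    rewrite (bigD1 w) //= eqxx [X in (_ + X)%N]big1 ?addn0 => [|w' /negPf->].
      by apply: eq_bigr => o' _; rewrite mul1n.
    by rewrite big1.
  by rewrite pair_bigA; apply: eq_bigr => -[].
case: pickP => [o' | /(_ o0)]; last by rewrite o0E eqxx.
by rewrite o0E => /eqP->; rewrite o0E eq_sym.
Qed.

(** Assignments meeting the one-hot constraints are pairs of a configuration and a vector [e]. A
    pair violating a guard has a weight that [e] turns into 0, so excluding it changes nothing. *)
Lemma config_sum_projection :
  projection
    (\sum_(e : {ffun 'I_u -> bool})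
       ((\sum_(f : config S D T | valid_config top ch f)
           \prod_(w : W) owt weight w.1 (f w)) \mPo subst e))
    (hyperpf_poly F k (hardness_size S D #|T| u)).
Proof.
have := @constrained_sum_projection F v k B U W C L co phi k_gt0 k_even isT co_le.
have -> : ((#|W| + #|C| * B).+1 * #|U|.+1)%N = hardness_size S D #|T| u.
  by rewrite /B !(card_sum, card_prod, card_option, card_ord).
move/projection_eq; apply.
rewrite (reindex_onto encode decode) /=; last first.
  move=> e /forallP e_ok; apply: decodeK => w.
  by have /eqP := e_ok (inl (inl w)).
rewrite (eq_bigl (fun p => valid_config top ch p.1 && guarded p.1 p.2)) => [|[f e]]; last first.
  by rewrite encodeK eqxx andbT phi_encode.
rewrite (eq_bigr (fun p : config S D T * _ =>
  \prod_(w : W) lit_poly (plain w.1 (p.1 w)))) => [|[f e] _]; last first.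
  exact: prod_encode.
rewrite big_mkcond.
rewrite -(pair_bigA _ (fun (f : config S D T) e => if valid_config top ch f && guarded f e then
  \prod_(w : W) lit_poly (plain w.1 (f w)) else 0)) exchange_big /=.
apply: eq_bigr => e _; rewrite rmorph_sum [RHS]big_mkcond; apply: eq_bigr => f _ /=.
by case: (valid_config top ch f) => //=; rewrite prod_subst.
Qed.

End Encoding.

Lemma circuit_projection (F : numClosedFieldType) (v u k s d : nat)
    (P : {mpoly F[v + u]}) (c : circuit F (v + u)) :
    (0 < k)%N -> ~~ odd k -> circuit_computes c P -> (size c <= s)%N ->
    (msize P <= d.+1)%N -> (0 < d)%N ->
  projection (boolean_sum P)
    (hyperpf_poly F k (hardness_size (s * d).+1 d d.+1 u)).
Proof.
move=> k_gt0 k_even [c_wf P_in] cs Pd d_gt0.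
pose out := index P (circuit_polys c).
have PE : (circuit_polys c)`_out = P by rewrite nth_index.
have out_lt : (out < s)%N.
  by apply: leq_trans cs; rewrite -size_circuit_polys index_mem.
have out_size : (msize (circuit_polys c)`_out <= d.+1)%N by rewrite PE.
pose term := @circuit_term F (v + u) s d out c.
have := @config_sum_projection F v u k (s * d).+1 d (s * d) 'I_d.+1 term
  (fun g a => circuit_term_size s out c g a) k_gt0 k_even.
rewrite card_ord => /projection_eq; apply; apply: eq_bigr => e _.
congr (_ \mPo _); rewrite -[RHS]PE.
transitivity (circuit_val s d out c (s * d)); last by rewrite /circuit_val eqxx.
apply/esym; apply: (@unfold_system _ _ _ _ _ (circuit_val s d out c)
  (fun g a => lit_poly (term g a).1) (fun g a => (term g a).2) (circuit_deg s d)).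
- exact: ltnSn.
- exact: circuit_val_eq.
- by move=> g a; apply: circuit_term_lt.
- by move=> g _; rewrite /circuit_deg; case: ifP.
- by move=> g a; apply: circuit_term_deg.
by rewrite /circuit_deg eqxx.
Qed.

(** * Building circuits *)

Section Computable.
Variables (F : fieldType) (v : nat).
Implicit Types (P Q : {mpoly F[v]}) (c : circuit F v).

Definition shift_gate (n : nat) (G : gate F v) : gate F v :=
  match G with
  | GAdd i j => GAdd F v (n + i) (n + j)
  | GMul i j => GMul F v (n + i) (n + j)
  | _ => G
  end.

Lemma circuit_polys_cat c c' :
  circuit_polys (c ++ map (shift_gate (size c)) c') =
  circuit_polys c ++ circuit_polys c'.
Proof.
elim/last_ind: c' => [|c' G IH] /=; first by rewrite !cats0.
rewrite map_rcons -rcons_cat !circuit_polys_rcons IH -rcons_cat; congr (rcons _ _).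
by case: G => //= i j;
  rewrite !nth_cat size_circuit_polys !(ltnNge (size c + _)) !leq_addr !addKn.
Qed.

Lemma circuit_wf_from_shift n pos c :
  circuit_wf_from (n + pos) (map (shift_gate n) c) = circuit_wf_from pos c.
Proof.
elim: c pos => //= G c IHc pos; rewrite -addnS IHc.
by case: G => //= i j; rewrite !ltn_add2l.
Qed.

(** One number bounds both circuit size and degree, as membership in VP asks for both; it is
    additive, up to one gate, under sums and products. *)
Definition computable_in P (s : nat) : Prop :=
  (exists2 c, (size c <= s)%N & circuit_computes c P) /\ (msize P <= s.+1)%N.

Lemma computable_var i : computable_in 'X_i 1.
Proof.
split; last by rewrite msizeX mdeg1.
by exists [:: GVar F i] => //; split=> //=; rewrite mem_seq1.
Qed.

Lemma computable_const a : computable_in a%:MP 1.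
Proof.
split; last by rewrite msizeC; case: (_ != _).
by exists [:: GConst v a] => //; split=> //=; rewrite mem_seq1.
Qed.

(** The second circuit is appended with its references shifted, and a final gate combines the two
    results. *)
Lemma computable_gate P Q R s t (G : nat -> nat -> gate F v) :
    (forall i j pos, gate_wf pos (G i j) = (i < pos)%N && (j < pos)%N) ->
    (forall vals i j, vals`_i = P -> vals`_j = Q -> gate_poly vals (G i j) = R) ->
    (exists2 c, (size c <= s)%N & circuit_computes c P) ->
    (exists2 c, (size c <= t)%N & circuit_computes c Q) ->
  exists2 c, (size c <= s + t + 1)%N & circuit_computes c R.
Proof.
move=> G_wf G_poly [c cs [c_wf P_in]] [c' c't [c'_wf Q_in]].
pose i := index P (circuit_polys c); pose j := index Q (circuit_polys c').
have i_lt : (i < size c)%N by rewrite -size_circuit_polys index_mem.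
have j_lt : (j < size c')%N by rewrite -size_circuit_polys index_mem.
exists (rcons (c ++ map (shift_gate (size c)) c') (G i (size c + j)%N)).
  by rewrite size_rcons size_cat size_map addn1 ltnS leq_add.
split.
  rewrite circuit_wf_rcons size_cat size_map G_wf ltn_add2l j_lt ltn_addr // andbT.
  rewrite /circuit_wf circuit_wf_from_cat -[circuit_wf_from 0 c]/(circuit_wf c) c_wf /= add0n.
  by have := circuit_wf_from_shift (size c) 0 c'; rewrite addn0 andbT => ->; apply: c'_wf.
rewrite circuit_polys_rcons circuit_polys_cat mem_rcons inE (G_poly _ _ _) ?eqxx //.
  by rewrite nth_cat size_circuit_polys i_lt nth_index.
by rewrite nth_cat size_circuit_polys ltnNge leq_addr /= addKn nth_index.
Qed.

Lemma computable_add P Q s t :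
  computable_in P s -> computable_in Q t -> computable_in (P + Q) (s + t + 1).
Proof.
move=> [cP dP] [cQ dQ]; split.
  by apply: (computable_gate (G := GAdd F v)) cP cQ => // vals i j /= -> ->.
by apply: leq_trans (msizeD_le _ _) _; rewrite geq_max; apply/andP; split; lia.
Qed.

Lemma computable_mul P Q s t :
  computable_in P s -> computable_in Q t -> computable_in (P * Q) (s + t + 1).
Proof.
move=> [cP dP] [cQ dQ]; split.
  by apply: (computable_gate (G := GMul F v)) cP cQ => // vals i j /= -> ->.
have [->|P0] := eqVneq P 0; first by rewrite mul0r msize0.
have [->|Q0] := eqVneq Q 0; first by rewrite mulr0 msize0.
rewrite msizeM //; apply: leq_trans (leq_pred _) _.
by apply: leq_trans (leq_add dP dQ) _; rewrite addn1 addSn addnS.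
Qed.

Lemma computable_le P s t : computable_in P s -> (s <= t)%N -> computable_in P t.
Proof.
move=> [[c cs cP] dP] st; split; last by apply: leq_trans dP _.
by exists c => //; apply: leq_trans st.
Qed.

Lemma size_index_enum (I : finType) : size (index_enum I) = #|I|.
Proof. by rewrite -sum1_size -sum1_card. Qed.

Lemma computable_sum (I : finType) (B : pred I) (G : I -> {mpoly F[v]}) s :
    (forall i, computable_in (G i) s) ->
  computable_in (\sum_(i | B i) G i) (#|I| * s.+1 + 1).
Proof.
move=> Gs; rewrite -size_index_enum; elim: (index_enum I) => [|i r IHr].
  by rewrite big_nil -mpolyC0; apply: computable_const.
rewrite big_cons /=; case: ifP => _.
  by apply: computable_le (computable_add (Gs i) IHr) _; lia.
by apply: computable_le IHr _; lia.
Qed.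

Lemma computable_prod (I : finType) (B : pred I) (G : I -> {mpoly F[v]}) s :
    (forall i, computable_in (G i) s) ->
  computable_in (\prod_(i | B i) G i) (#|I| * s.+1 + 1).
Proof.
move=> Gs; rewrite -size_index_enum; elim: (index_enum I) => [|i r IHr].
  by rewrite big_nil -mpolyC1; apply: computable_const.
rewrite big_cons /=; case: ifP => _.
  by apply: computable_le (computable_mul (Gs i) IHr) _; lia.
by apply: computable_le IHr _; lia.
Qed.

Lemma computable_sum_ord n (B : pred 'I_n) (G : 'I_n -> {mpoly F[v]}) s :
    (forall i, computable_in (G i) s) ->
  computable_in (\sum_(i < n | B i) G i) (n * s.+1 + 1).
Proof. by move=> Gs; have := computable_sum B Gs; rewrite card_ord. Qed.

Lemma computable_prod_ord n (B : pred 'I_n) (G : 'I_n -> {mpoly F[v]}) s :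
    (forall i, computable_in (G i) s) ->
  computable_in (\prod_(i < n | B i) G i) (n * s.+1 + 1).
Proof. by move=> Gs; have := computable_prod B Gs; rewrite card_ord. Qed.

End Computable.

(** * The hyperpfaffian as a Boolean sum *)

(** The Vandermonde matrix of the values of [J] is that of [0, ..., N - 1] times the transposed
    selection matrix. *)
Lemma Vandermonde_selection (A : comPzRingType) (N : nat) (J : multi_index N N) :
  \prod_(i < N) \prod_(j < N | (i < j)%N) ((J j)%:R - (J i)%:R) =
  (\prod_(i < N) \prod_(j < N | (i < j)%N) (j%:R - i%:R)) *
  \det (selection_mx A J) :> A.
Proof.
have vE (f : 'I_N -> 'I_N) :
    \prod_(i < N) \prod_(j < N | (i < j)%N) ((f j)%:R - (f i)%:R) =
    \det (Vandermonde N (\row_j (f j)%:R)) :> A.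
  rewrite det_Vandermonde; apply: eq_bigr => i _; apply: eq_bigr => j _.
  by rewrite !mxE.
rewrite vE (vE id) -[X in _ * X]det_tr -det_mulmx; congr (\det _).
apply/matrixP => i j; rewrite !mxE (bigD1 (J j)) //= !mxE eqxx mulr1.
by rewrite big1 ?addr0 // => l ne; rewrite !mxE eq_sym (negPf ne) mulr0.
Qed.

Lemma hyperpf_poly_sum (F : numFieldType) (k n : nat) :
  hyperpf_poly F k n =
  ((2 * k * n)`!)%:R^-1 *:
    \sum_(J : multi_index (2 * k * n) (2 * k * n))
      \det (selection_mx _ J) *
      \prod_(i < n) 'X_(enum_rank [ffun j => J (block_pos i j)]).
Proof.
rewrite -{1}[hyperpf_poly F k n]comp_mpoly_id hyperpf_poly_comp; congr (_ *: _).
by apply: eq_bigr => J _; congr (_ * _); apply: eq_bigr => i _; rewrite tnth_mktuple.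
Qed.

Lemma msize_hyperpf_poly (F : numFieldType) (k n : nat) :
  (msize (hyperpf_poly F k n) <= n.+1)%N.
Proof.
rewrite hyperpf_poly_sum; apply: leq_trans (mmeasureZ_le _ _ _) _.
apply: leq_trans (msize_sum _ _ _) _; apply/bigmax_leqP => J _.
rewrite -(rmorph_det_selection (@mpolyC _ F)) mul_mpolyC.
apply: leq_trans (mmeasureZ_le _ _ _) _.
rewrite mprodXE msizeX ltnS mdeg_sum (eq_bigr (fun=> 1%N)) => [|i _].
  by rewrite sum1_card card_ord.
exact: mdeg1.
Qed.

Section Witness.
Variables (F : numFieldType) (k n : nat).
Let N := (2 * k * n)%N.
Let Q := #|multi_index (2 * k) N|.
Let u := #|{: 'I_N * 'I_N}|.

Let bit (a b : 'I_N) : {mpoly F[Q + u]} := 'X_(rshift Q (enum_rank (a, b))).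
Let entry (I : multi_index (2 * k) N) : {mpoly F[Q + u]} :=
  'X_(lshift u (enum_rank I)).
Let pos (a : 'I_N) : {mpoly F[Q + u]} := \sum_(b < N) (b%:R)%:MP * bit a b.

(** The value at 1 of a polynomial that vanishes at the other numbers up to [N]; it normalises the
    test that a row contains a single bit. *)
Let chi1 : F := \prod_(c < N.+1 | c != 1%N :> nat) (1 - c%:R).
Let vand : F := \prod_(i < N) \prod_(j < N | (i < j)%N) (j%:R - i%:R).

(** The bits encode the graph of a map [J], and [pos a] evaluates to [J a]. After the normalising
    constant come the test that every row is one-hot, the Vandermonde product giving the sign of
    [J], and for each block the sum that picks out its coordinate. *)
Definition hyperpf_witness : {mpoly F[Q + u]} :=
  ((N`!)%:R^-1 / vand / chi1 ^+ N)%:MP *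
  (\prod_(a < N) \prod_(c < N.+1 | c != 1%N :> nat)
     (\sum_(b < N) bit a b + (- c%:R)%:MP)) *
  (\prod_(i < N) \prod_(j < N | (i < j)%N) (pos j + (-1)%:MP * pos i)) *
  \prod_(i < n) \sum_I entry I * \prod_(j < 2 * k) bit (block_pos i j) (I j).

Definition witness_size : nat :=
  let row := (N * 2 + 1)%N in
  let rows := (N * (N.+1 * (row + 1 + 1).+1 + 1).+1 + 1)%N in
  let psize := (N * (1 + 1 + 1).+1 + 1)%N in
  let diff := (psize + (1 + psize + 1) + 1)%N in
  let diffs := (N * (N * diff.+1 + 1).+1 + 1)%N in
  let block := (N ^ (2 * k) * (1 + (2 * k * 2 + 1) + 1).+1 + 1)%N in
  (1 + rows + 1 + diffs + 1 + (n * block.+1 + 1) + 1)%N.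

Lemma hyperpf_witness_computable : computable_in hyperpf_witness witness_size.
Proof.
have bitC a b : computable_in (bit a b) 1 by apply: computable_var.
have posC a : computable_in (pos a) (N * (1 + 1 + 1).+1 + 1).
  apply: computable_sum_ord => b.
  by apply: computable_mul; [apply: computable_const | apply: bitC].
apply: computable_mul; [apply: computable_mul; [apply: computable_mul|]|].
- exact: computable_const.
- do 2!apply: computable_prod_ord => ?.
  apply: computable_add; last exact: computable_const.
  by apply: computable_sum_ord => b; apply: bitC.
- do 2!apply: computable_prod_ord => ?.
  apply: computable_add => //; apply: computable_mul => //; exact: computable_const.
apply: computable_prod_ord => i.
rewrite -(card_multi_index (2 * k) N); apply: computable_sum => I.
apply: computable_mul; first exact: computable_var.
by apply: computable_prod_ord => j; apply: bitC.
Qed.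

Let chi1_neq0 : chi1 != 0.
Proof.
apply/prodf_neq0 => c c1; rewrite subr_eq0 -[1]/(1%:R) eqr_nat eq_sym.
by apply: contraNneq c1 => ->.
Qed.

Let vand_neq0 : vand != 0.
Proof.
apply/prodf_neq0 => i _; apply/prodf_neq0 => j ij.
by rewrite subr_eq0 eqr_nat gtn_eqF.
Qed.

Let encode (J : multi_index N N) : {ffun 'I_u -> bool} :=
  [ffun x => J (enum_val x).1 == (enum_val x).2].

Let decode (e : {ffun 'I_u -> bool}) : multi_index N N :=
  [ffun a => odflt a [pick b | e (enum_rank (a, b))]].

Let one_hot (e : {ffun 'I_u -> bool}) : bool :=
  [forall a : 'I_N, \sum_(b < N) e (enum_rank (a, b)) == 1]%N.

Let subst (e : {ffun 'I_u -> bool}) : (Q + u).-tuple {mpoly F[Q]} :=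
  [tuple match split i with inl j => 'X_j | inr j => (e j)%:R end | i < Q + u].

Let bit_subst e a b : bit a b \mPo subst e = (e (enum_rank (a, b)))%:R.
Proof.
rewrite comp_mpolyXU -tnth_nth tnth_mktuple.
by rewrite -[rshift _ _]/(unsplit (inr _)) unsplitK.
Qed.

Let entry_subst e I : entry I \mPo subst e = 'X_(enum_rank I).
Proof.
rewrite comp_mpolyXU -tnth_nth tnth_mktuple.
by rewrite -[lshift _ _]/(unsplit (inl _)) unsplitK.
Qed.

Let row_subst e a c :
  (\sum_(b < N) bit a b + (- c%:R)%:MP) \mPo subst e =
  (\sum_(b < N) e (enum_rank (a, b)))%:R - c%:R.
Proof.
rewrite rmorphD rmorph_sum /= comp_mpolyC mpolyCN mpolyC_nat natr_sum.
by congr (_ - _); apply: eq_bigr => b _; rewrite bit_subst.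
Qed.

(** A row with [m] bits set, where [m <= N] and [m] is not 1, makes the factor for [c = m]
    vanish. *)
Let witness_not_one_hot e : ~~ one_hot e -> hyperpf_witness \mPo subst e = 0.
Proof.
case/forallPn => a a_neq1; rewrite !rmorphM /= [X in _ * X * _ * _]rmorph_prod /=.
rewrite [X in _ * X * _ * _](bigD1 a) //= rmorph_prod.
pose m := (\sum_(b < N) e (enum_rank (a, b)))%N.
have m_lt : (m < N.+1)%N.
  rewrite ltnS -[X in (_ <= X)%N](card_ord N) -sum1_card; apply: leq_sum => b _.
  by case: (e _).
rewrite [X in _ * (X * _)](bigD1 (Ordinal m_lt)) //= row_subst subrr.
by rewrite !(mul0r, mulr0).
Qed.

Let witness_one_hot J :
  hyperpf_witness \mPo subst (encode J) =
  (N`!)%:R^-1 *: (\det (selection_mx _ J) *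
     \prod_(i < n) 'X_(enum_rank [ffun j => J (block_pos i j)])).
Proof.
have encE a b : encode J (enum_rank (a, b)) = (J a == b) by rewrite ffunE enum_rankK.
have posE a : pos a \mPo subst (encode J) = (J a)%:R.
  rewrite rmorph_sum (bigD1 (J a)) //= rmorphM /= comp_mpolyC bit_subst encE eqxx.
  rewrite mulr1 mpolyC_nat big1 ?addr0 // => b ne.
  by rewrite rmorphM /= bit_subst encE eq_sym (negPf ne) mulr0.
have rowE a : (\sum_(b < N) encode J (enum_rank (a, b)) = 1)%N.
  rewrite (bigD1 (J a)) //= encE eqxx big1 ?addn0 // => b ne.
  by rewrite encE eq_sym (negPf ne).
rewrite !rmorphM /= comp_mpolyC !rmorph_prod /=.
have -> : \prod_(a < N) ((\prod_(c < N.+1 | c != 1%N :> nat)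
     (\sum_(b < N) bit a b + (- c%:R)%:MP)) \mPo subst (encode J)) = (chi1 ^+ N)%:MP.
  rewrite (eq_bigr (fun=> chi1%:MP)) => [|a _].
    by rewrite prodr_const card_ord rmorphXn.
  rewrite !rmorph_prod; apply: eq_bigr => c _.
  by rewrite /= row_subst rowE rmorphB /= mpolyC1 mpolyC_nat.
have -> : \prod_(i < N) ((\prod_(j < N | (i < j)%N)
     (pos j + (-1)%:MP * pos i)) \mPo subst (encode J)) =
    vand%:MP * \det (selection_mx _ J).
  transitivity (\prod_(i < N) \prod_(j < N | (i < j)%N) ((J j)%:R - (J i)%:R)
                : {mpoly F[Q]}).
    apply: eq_bigr => i _; rewrite rmorph_prod; apply: eq_bigr => j _.
    by rewrite rmorphD rmorphM /= comp_mpolyC !posE mpolyCN mpolyC1 mulN1r.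
  rewrite Vandermonde_selection; congr (_ * _).
  rewrite /vand rmorph_prod; apply: eq_bigr => i _.
  by rewrite rmorph_prod; apply: eq_bigr => j _; rewrite rmorphB /= !mpolyC_nat.
have -> : \prod_(i < n) ((\sum_I entry I * \prod_(j < 2 * k) bit (block_pos i j) (I j))
      \mPo subst (encode J)) =
    \prod_(i < n) 'X_(enum_rank [ffun j => J (block_pos i j)]).
  apply: eq_bigr => i _.
  (* Only the index read off from [J] on this block has all its bits set. *)
  rewrite rmorph_sum (bigD1 [ffun j => J (block_pos i j)]) //= [X in _ + X]big1 => [|I ne].
    rewrite addr0 rmorphM /= entry_subst rmorph_prod big1 ?mulr1 // => j _.
    by rewrite /= bit_subst encE ffunE eqxx.
  rewrite rmorphM /= rmorph_prod; have [j ne_j] : exists j, J (block_pos i j) != I j.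
    apply/existsP; apply: contraNT ne; rewrite negb_exists => /forallP H.
    by apply/eqP/ffunP => j; rewrite ffunE; have := H j; rewrite negbK => /eqP.
  by rewrite (bigD1 j) //= bit_subst encE (negPf ne_j) mul0r mulr0.
rewrite !comp_mpolyC -!mpolyCM mulrA -mpolyCM divfK ?expf_neq0 // divfK //.
by rewrite -mulrA mul_mpolyC.
Qed.

Lemma hyperpf_witnessE : hyperpf_poly F k n = boolean_sum hyperpf_witness.
Proof.
rewrite /boolean_sum (bigID one_hot) /= [X in _ = _ + X]big1 => [|e]; last first.
  exact: witness_not_one_hot.
rewrite addr0 (reindex_onto encode decode) => [|e /forallP e1]; last first.
  apply/ffunP => x; rewrite !ffunE -[in RHS](enum_valK x).
  case: (enum_val x) => a b /=; have /eqP/one_hotP[b0 b0E] := e1 a.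
  case: pickP => [b'|/(_ b0)]; last by rewrite b0E eqxx.
  by rewrite !b0E => /eqP->; rewrite eq_sym.
rewrite hyperpf_poly_sum scaler_sumr; apply: eq_big => [J | J _]; last first.
  exact/esym/witness_one_hot.
apply/esym/andP; split.
  apply/forallP => a; rewrite (bigD1 (J a)) //= ffunE enum_rankK eqxx big1 // => b ne.
  by rewrite ffunE enum_rankK /= eq_sym (negPf ne).
apply/eqP/ffunP => a; rewrite ffunE; case: pickP => [b|/(_ (J a))].
  by rewrite ffunE enum_rankK => /eqP.
by rewrite ffunE enum_rankK eqxx.
Qed.

End Witness.

(** * Completeness *)

Ltac p_bound := repeat first
  [ assumption | exact: p_bounded_const | exact: p_bounded_id
  | apply: p_bounded_succ | apply: p_bounded_add | apply: p_bounded_mul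
  | apply: p_bounded_exp ].

Lemma p_bounded_hardness_size (S D T u : nat -> nat) :
    p_bounded S -> p_bounded D -> p_bounded T -> p_bounded u ->
  p_bounded (fun n => hardness_size (S n) (D n) (T n) (u n)).
Proof. by move=> Sb Db Tb ub; rewrite /hardness_size; p_bound. Qed.

Lemma hyperpf_family_in_VNP (F : numFieldType) (k : nat) :
  in_VNP (hyperpf_family F k).
Proof.
have N_bnd : p_bounded (fun n => 2 * k * n.+1)%N by p_bound.
have Q_bnd : p_bounded (fun n => #|multi_index (2 * k) (2 * k * n.+1)|).
  apply: p_bounded_le (p_bounded_exp (2 * k) N_bnd) => n.
  by rewrite card_multi_index.
have W_bnd : p_bounded (fun n => witness_size k n.+1).
  by rewrite /witness_size; p_bound.
have witness_ok n := hyperpf_witness_computable F k n.+1.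
split.
  split=> //=; apply: p_bounded_le (p_bounded_succ p_bounded_id) => n.
  by have := msize_hyperpf_poly F k n.+1; case: (msize _).
exists (fun n => #|{: 'I_(2 * k * n.+1) * 'I_(2 * k * n.+1)}|).
exists (fun n => hyperpf_witness F k n.+1); split; last first.
  by move=> n; apply: hyperpf_witnessE.
split.
  split=> /=.
    apply: p_bounded_add => //.
    apply: p_bounded_le (p_bounded_mul N_bnd N_bnd) => n.
    by rewrite card_prod card_ord.
  apply: p_bounded_le W_bnd => n; have [_] := witness_ok n.
  by case: (msize _).
by exists (fun n => witness_size k n.+1) => // n; have [] := witness_ok n.
Qed.

Lemma VNP_p_projection_hyperpf (F : numClosedFieldType) (k : nat) (f : poly_family F) :
  (0 < k)%N -> ~~ odd k -> in_VNP f -> p_projection f (hyperpf_family F k).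
Proof.
move=> k_gt0 k_even [_ [u [g [[[vars_bnd deg_bnd] [s s_bnd circ]] fE]]]] /=.
rewrite /= in vars_bnd deg_bnd circ.
have u_bnd : p_bounded u by apply: p_bounded_le vars_bnd => n; rewrite leq_addl.
(* One more than the degree, so that the number of copies of a gate is positive even for
   constants. *)
pose d n := (msize (g n)).-1.+1.
have d_bnd : p_bounded d by apply: p_bounded_succ.
pose t n := hardness_size (s n * d n).+1 (d n) (d n).+1 (u n).
(* The polynomial of parameter [m] is stored at index [m - 1]; [t n] is positive, being a product of
   successors. *)
exists (fun n => (t n).-1).
  apply: p_bounded_le (fun n => leq_pred _) _.
  by apply: p_bounded_hardness_size; p_bound.
move=> n; rewrite fE /=.
suff proj m : m = t n -> projection (boolean_sum (g n)) (hyperpf_poly F k m).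
  by apply: (proj _ (prednK _)); rewrite muln_gt0.
move=> ->; have [c cs cP] := circ n.
by apply: circuit_projection cP cs _ _ => //; rewrite /d; case: (msize _).
Qed.

(* R[i] with R the real numbers is the field of complex numbers. *)
Theorem theorem4p3 (R : realType) (k : nat) (k_gt0 : (0 < k)%N)
    (k_even : ~~ odd k) :
  VNP_complete (hyperpf_family R[i] k).
Proof.
split; first exact: hyperpf_family_in_VNP.
by move=> f; apply: VNP_p_projection_hyperpf.
Qed.
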